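(* Let $G$ be a groupoid, let $E$ be a set of representatives of the equivalence classes of $\mathrm{ob}(G)$ under the relation $e\sim f$ iff there is a morphism from $e$ to $f$, and for each $e\in E$ let $R_e$ be a unital non-associative ring. Then the groupoid ring $R[G]$ is left (respectively right) artinian if and only if $\mathrm{mor}(G)$ is finite and for each $e\in E$ the ring $R_e$ is left (respectively right) artinian.
   Context: A ''non-associative ring'' is an additive abelian group with a multiplication distributive over addition, not assumed associative; the identity of a unital ring is assumed non-zero. A ring is left (right) artinian if it satisfies the descending chain condition on left (right) ideals (additive subgroups closed under left (right) multiplication by all ring elements). A groupoid $G$ is a small category in which all morphisms are isomorphisms, with objects $\mathrm{ob}(G)$ and morphisms $\mathrm{mor}(G)$ (objects are identified with identity morphisms); $d(g)$ and $c(g)$ denote the domain and codomain of $g\in\mathrm{mor}(G)$; $(g,h)$ is composable, with composite $gh$, when $d(g)=c(h)$. For $g\in\mathrm{mor}(G)$ let $e(g)$ be the unique element of $E$ with $c(g)\sim e(g)$, and put $R_g=R_{e(g)}$; in particular, for an object $f$, $R_f$ is (a copy of) $R_{e(f)}$. Put $R=\bigoplus_{f\in\mathrm{ob}(G)}R_f$, and let $\alpha_g:R_{g^{-1}}\to R_g$ be the identity map. The groupoid ring $R[G]$ is the resulting (partial) skew groupoid ring: the set of finite formal sums $\sum_{g\in\mathrm{mor}(G)}r_g\delta_g$ with $r_g\in R_g=R_{e(g)}$, with componentwise addition and multiplication determined by $(r\delta_g)(s\delta_h)=(rs)\delta_{gh}$ if $d(g)=c(h)$ and $(r\delta_g)(s\delta_h)=0$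 otherwise. *)

(* Defs.v *)
From HB Require Import structures.
From mathcomp Require Import all_boot all_algebra.
From mathcomp Require Import boolp classical_sets functions cardinality fsbigop.

Set Implicit Arguments.
Unset Strict Implicit.
Unset Printing Implicit Defensive.

Import GRing.Theory.
Local Open Scope classical_set_scope.
Local Open Scope ring_scope.

HB.mixin Record Zmodule_isNonAssocRing R of GRing.Zmodule R := {
  namul : R -> R -> R;
  namulDl : left_distributive namul +%R;
  namulDr : right_distributive namul +%R
}.

#[short(type="naRingType")]
HB.structure Definition NonAssocRing :=
  { R of Zmodule_isNonAssocRing R & GRing.Zmodule R }.

HB.mixin Record NonAssocRing_isUnital R of NonAssocRing R := {
  naone : R;
  namul1r : left_id naone (@namul R);
  namulr1 : right_id naone (@namul R);
  naone_neq0 : naone != 0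
}.

#[short(type="unaRingType")]
HB.structure Definition UnitalNonAssocRing :=
  { R of NonAssocRing_isUnital R & NonAssocRing R }.

Section NonAssocTheory.
Variable R : naRingType.
Implicit Types x y : R.

Lemma namul0r x : namul 0 x = 0.
Proof. by apply: (@addIr _ (namul 0 x)); rewrite -namulDl !add0r. Qed.

Lemma namulr0 x : namul x 0 = 0.
Proof. by apply: (@addIr _ (namul x 0)); rewrite -namulDr !add0r. Qed.

End NonAssocTheory.

Definition additive_subgroup (A : zmodType) (I : set A) : Prop :=
  [/\ I 0, forall x y, I x -> I y -> I (x + y) & forall x, I x -> I (- x)].

Definition left_ideal (A : naRingType) (I : set A) : Prop :=
  additive_subgroup I /\ forall a x : A, I x -> I (namul a x).

Definition right_ideal (A : naRingType) (I : set A) : Prop :=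
  additive_subgroup I /\ forall a x : A, I x -> I (namul x a).

Definition descending_chain_condition (T : Type) (P : set T -> Prop) : Prop :=
  forall I : nat -> set T,
    (forall n, P (I n)) -> (forall n, I n.+1 `<=` I n) ->
    exists N, forall n, (N <= n)%N -> I n = I N.

Definition left_artinian (A : naRingType) : Prop :=
  descending_chain_condition (@left_ideal A).

Definition right_artinian (A : naRingType) : Prop :=
  descending_chain_condition (@right_ideal A).

(* [gcomp g h] is the composite gh, meaningful only when [gdom g = gcod h]; it is
   a total function whose value on non-composable pairs is unconstrained. *)
Record groupoid := Groupoid {
  ob : Type;
  mor : choiceType;
  gdom : mor -> ob;
  gcod : mor -> ob;
  idm : ob -> mor;
  gcomp : mor -> mor -> mor;
  gdom_idm : forall f, gdom (idm f) = f;
  gcod_idm : forall f, gcod (idm f) = f;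
  gdom_comp : forall g h, gdom g = gcod h -> gdom (gcomp g h) = gdom h;
  gcod_comp : forall g h, gdom g = gcod h -> gcod (gcomp g h) = gcod g;
  gcomp_idl : forall g, gcomp (idm (gcod g)) g = g;
  gcomp_idr : forall g, gcomp g (idm (gdom g)) = g;
  gcompA : forall g h k, gdom g = gcod h -> gdom h = gcod k ->
    gcomp g (gcomp h k) = gcomp (gcomp g h) k;
  mor_iso : forall g, exists h,
    [/\ gdom h = gcod g, gcod h = gdom g,
        gcomp g h = idm (gcod g) & gcomp h g = idm (gdom g)]
}.

Arguments gdom {_} _.
Arguments gcod {_} _.
Arguments idm {_} _.
Arguments gcomp {_} _ _.

Definition connected_ob (G : groupoid) (e f : ob G) : Prop :=
  exists g : mor G, gdom g = e /\ gcod g = f.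

(* A set E coerces to the subtype of its elements, so that a family
   indexed by E has type [E -> unaRingType]. *)
Definition representatives (G : groupoid) (E : set (ob G)) : Prop :=
  forall f : ob G, exists! e : ob G, E e /\ connected_ob f e.

Lemma connected_ob_sym (G : groupoid) (e f : ob G) :
  connected_ob e f -> connected_ob f e.
Proof.
by move=> [g [<- <-]]; have [h [dh ch _ _]] := mor_iso g; exists h.
Qed.

Lemma connected_ob_trans (G : groupoid) (e f k : ob G) :
  connected_ob e f -> connected_ob f k -> connected_ob e k.
Proof.
move=> [g [<- cg]] [h [dh <-]]; exists (gcomp h g).
by rewrite gdom_comp ?gcod_comp // dh cg.
Qed.

Section Representative.
Variables (G : groupoid) (E : set (ob G)) (hE : representatives E).

Definition repr_ob (f : ob G) : E :=
  let (e, he) := cid (hE f) in exist _ e (mem_set (proj1 (proj1 he))).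

(* The index e(g): the unique e in E with c(g) ~ e. *)
Definition repr_mor (g : mor G) : E := repr_ob (gcod g).

Lemma repr_obP (f : ob G) : connected_ob f (val (repr_ob f)).
Proof. by rewrite /repr_ob; case: cid => e [[]]. Qed.

Lemma repr_ob_unique (f : ob G) (e : E) :
  connected_ob f (val e) -> repr_ob f = e.
Proof.
move=> fe; apply: val_inj; have [u [_ uniq_u]] := hE f.
rewrite -(uniq_u (val e)); last by split=> //; exact: set_valP.
by apply/esym/uniq_u; split; [exact: set_valP | exact: repr_obP].
Qed.

Lemma repr_mor_dom (g : mor G) : repr_mor g = repr_ob (gdom g).
Proof.
apply: repr_ob_unique; apply: connected_ob_trans (repr_obP (gdom g)).
by apply: connected_ob_sym; exists g.
Qed.

Lemma repr_mor_compl (g h : mor G) :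
  gdom g = gcod h -> repr_mor g = repr_mor (gcomp g h).
Proof. by move=> gh; rewrite /repr_mor gcod_comp. Qed.

Lemma repr_mor_compr (g h : mor G) :
  gdom g = gcod h -> repr_mor h = repr_mor (gcomp g h).
Proof. by move=> gh; rewrite -(repr_mor_compl gh) (repr_mor_dom g) gh. Qed.

End Representative.

(* Identification of [R i] with [R j] when [i = j]; the value 0 for [i <> j]
   is a placeholder, never reached in the product of the groupoid ring. *)
Definition transport (I : Type) (R : I -> zmodType) (i j : I) (r : R i) : R j :=
  match pselect (i = j) with
  | left ij => eq_rect i (fun k => R k) r j ij
  | right _ => 0
  end.

Section Transport.
Variables (I : Type) (R : I -> naRingType).
Implicit Types i j k : I.

Lemma transport_id i (r : R i) : transport (R := R) i r = r.
Proof.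
by rewrite /transport; case: pselect => // p; rewrite (Prop_irrelevance p erefl).
Qed.

Lemma transportD i j (r s : R i) :
  transport (R := R) j (r + s) =
  transport (R := R) j r + transport (R := R) j s.
Proof. by rewrite /transport; case: pselect => [p|_]; [case: _ / p | rewrite addr0]. Qed.

Lemma transport0 i j : transport (R := R) j (0 : R i) = 0.
Proof. by rewrite /transport; case: pselect => // p; case: _ / p. Qed.

End Transport.

Section GroupoidRing.
Variables (G : groupoid) (E : set (ob G)) (hE : representatives E).
Variable R : E -> unaRingType.
Local Notation rep := (repr_mor hE).

(* The formal sum \sum_g r_g delta_g is encoded by its coefficients r_g, with
   r_g in R_(e(g)). *)
Record groupoid_ring := GroupoidRing {
  coef : forall g : mor G, R (rep g);
  coef_fin : finite_set [set g | coef g <> 0]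
}.

HB.instance Definition _ := gen_eqMixin groupoid_ring.
HB.instance Definition _ := gen_choiceMixin groupoid_ring.

Lemma groupoid_ringP (x y : groupoid_ring) :
  (forall g, coef x g = coef y g) -> x = y.
Proof.
case: x y => [x fx] [y fy] /= xy.
have exy : x = y by exact: functional_extensionality_dep.
by case: _ / exy fy {xy} => fy; congr GroupoidRing; exact: Prop_irrelevance.
Qed.

Lemma gr0_fin : finite_set [set g | (0 : R (rep g)) <> 0].
Proof. by rewrite (_ : mkset _ = set0) ?finite_set0 //; apply/seteqP; split=> g. Qed.

Lemma grN_fin (x : groupoid_ring) : finite_set [set g | - coef x g <> 0].
Proof.
by apply: sub_finite_set (coef_fin x) => g /=; apply: contra_not => ->;
  rewrite oppr0.
Qed.

Lemma grD_fin (x y : groupoid_ring) :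
  finite_set [set g | coef x g + coef y g <> 0].
Proof.
have fxy : finite_set ([set g | coef x g <> 0] `|` [set g | coef y g <> 0]).
  by rewrite finite_setU; split; exact: coef_fin.
apply: sub_finite_set fxy => g /= xyg; apply: contrapT.
by move=> /not_orP[/contrapT x0 /contrapT y0]; apply: xyg; rewrite x0 y0 addr0.
Qed.

Definition gr0 := GroupoidRing gr0_fin.
Definition grN x := GroupoidRing (grN_fin x).
Definition grD x y := GroupoidRing (grD_fin x y).

Lemma grDA : associative grD.
Proof. by move=> x y z; apply: groupoid_ringP => g /=; rewrite addrA. Qed.

Lemma grDC : commutative grD.
Proof. by move=> x y; apply: groupoid_ringP => g /=; rewrite addrC. Qed.

Lemma gr0D : left_id gr0 grD.
Proof. by move=> x; apply: groupoid_ringP => g /=; rewrite add0r. Qed.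

Lemma grND : left_inverse gr0 grN grD.
Proof. by move=> x; apply: groupoid_ringP => g /=; rewrite addNr. Qed.

HB.instance Definition _ :=
  GRing.isZmodule.Build groupoid_ring grDA grDC gr0D grND.

Lemma coefD (x y : groupoid_ring) g : coef (x + y) g = coef x g + coef y g.
Proof. by []. Qed.

Definition factorizations (k : mor G) : set (mor G * mor G) :=
  [set p | gdom p.1 = gcod p.2 /\ gcomp p.1 p.2 = k].

Definition mul_coef (x y : groupoid_ring) (k : mor G) : R (rep k) :=
  \sum_(p \in factorizations k)
    namul (transport (R := R) (rep k) (coef x p.1))
          (transport (R := R) (rep k) (coef y p.2)).

Lemma mul_coef_fin (x y : groupoid_ring) :
  finite_set [set k | mul_coef x y k <> 0].
Proof.
have fxy : finite_set ((fun p : mor G * mor G => gcomp p.1 p.2) @`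
    ([set g | coef x g <> 0] `*` [set h | coef y h <> 0])).
  by apply: finite_image; apply: finite_setX; exact: coef_fin.
apply: sub_finite_set fxy => k /= xyk; apply: contrapT => Nk; apply: xyk.
apply: fsbig1 => p [_ pk]; have [x0|x0] := pselect (coef x p.1 = 0).
  by rewrite x0 transport0 namul0r.
have [y0|y0] := pselect (coef y p.2 = 0).
  by rewrite y0 transport0 namulr0.
by exfalso; apply: Nk; exists p.
Qed.

Definition gr_mul x y := GroupoidRing (mul_coef_fin x y).

Lemma mul_coefE (A B : set (mor G)) (x y : groupoid_ring) k :
  [set g | coef x g <> 0] `<=` A -> [set g | coef y g <> 0] `<=` B ->
  mul_coef x y k = \sum_(p \in factorizations k `&` (A `*` B))
    namul (transport (R := R) (rep k) (coef x p.1))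
          (transport (R := R) (rep k) (coef y p.2)).
Proof.
move=> xA yB; apply/esym/fsbig_widen => [p [] //|p [kp Np] /=].
have [x0|/xA x0] := pselect (coef x p.1 = 0).
  by rewrite x0 transport0 namul0r.
have [y0|/yB y0] := pselect (coef y p.2 = 0).
  by rewrite y0 transport0 namulr0.
by exfalso; apply: Np.
Qed.

Lemma supp_fin2 (x y : groupoid_ring) : exists A : set (mor G),
  [/\ finite_set A, [set g | coef x g <> 0] `<=` A,
      [set g | coef y g <> 0] `<=` A & [set g | coef (x + y) g <> 0] `<=` A].
Proof.
exists ([set g | coef x g <> 0] `|` [set g | coef y g <> 0]); split.
- by rewrite finite_setU; split; exact: coef_fin.
- by move=> g; left.
- by move=> g; right.
move=> g xyg; apply: contrapT => /not_orP[/contrapT x0 /contrapT y0].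
by apply: (xyg : coef (x + y) g <> 0); rewrite coefD x0 y0 addr0.
Qed.

Lemma gr_mulDl : left_distributive gr_mul +%R.
Proof.
move=> x y z; apply: groupoid_ringP => k.
have [A [fA xA yA xyA]] := supp_fin2 x y.
have zz := @subset_refl _ [set g | coef z g <> 0].
have fP : finite_set (factorizations k `&` (A `*` [set g | coef z g <> 0])).
  by apply: finite_setIr; apply: finite_setX => //; exact: coef_fin.
rewrite coefD.
change (mul_coef (x + y) z k = mul_coef x z k + mul_coef y z k).
rewrite (mul_coefE k xyA zz) (mul_coefE k xA zz) (mul_coefE k yA zz).
rewrite -fsbig_split //.
by apply: eq_fsbigr => p _; rewrite coefD transportD namulDl.
Qed.

Lemma gr_mulDr : right_distributive gr_mul +%R.
Proof.
move=> z x y; apply: groupoid_ringP => k.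
have [A [fA xA yA xyA]] := supp_fin2 x y.
have zz := @subset_refl _ [set g | coef z g <> 0].
have fP : finite_set (factorizations k `&` ([set g | coef z g <> 0] `*` A)).
  by apply: finite_setIr; apply: finite_setX => //; exact: coef_fin.
rewrite coefD.
change (mul_coef z (x + y) k = mul_coef z x k + mul_coef z y k).
rewrite (mul_coefE k zz xyA) (mul_coefE k zz xA) (mul_coefE k zz yA).
rewrite -fsbig_split //.
by apply: eq_fsbigr => p _; rewrite coefD transportD namulDr.
Qed.

HB.instance Definition _ :=
  Zmodule_isNonAssocRing.Build groupoid_ring gr_mulDl gr_mulDr.

Lemma coefM (x y : groupoid_ring) k : coef (namul x y) k = mul_coef x y k.
Proof. by []. Qed.

Definition delta_coef (g : mor G) (r : R (rep g)) (k : mor G) : R (rep k) :=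
  if pselect (g = k) then transport (R := R) (rep k) r else 0.

Lemma delta_coef_fin (g : mor G) (r : R (rep g)) :
  finite_set [set k | delta_coef r k <> 0].
Proof.
apply: sub_finite_set (finite_set1 g) => k /=.
by rewrite /delta_coef; case: pselect => [gk|//] _; rewrite gk.
Qed.

(* The formal sum r delta_g; [gr_mul_delta] and [gr_mul_delta0] below are the
   defining rules of the product. *)
Definition gr_delta (g : mor G) (r : R (rep g)) : groupoid_ring :=
  GroupoidRing (delta_coef_fin r).

Lemma coef_delta (g : mor G) (r : R (rep g)) : coef (gr_delta r) g = r.
Proof.
by rewrite /= /delta_coef; case: pselect => [gg|//]; rewrite transport_id.
Qed.

Lemma coef_delta_neq (g k : mor G) (r : R (rep g)) :
  g <> k -> coef (gr_delta r) k = 0.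
Proof. by rewrite /= /delta_coef; case: pselect. Qed.

Lemma mul_delta_term0 (g h g' h' : mor G) (r : R (rep g)) (s : R (rep h)) e :
  (g, h) <> (g', h') ->
  namul (transport (R := R) e (coef (gr_delta r) g'))
        (transport (R := R) e (coef (gr_delta s) h')) = 0.
Proof.
move=> gh; have [gg'|gg'] := pselect (g = g'); last first.
  by rewrite (coef_delta_neq _ gg') transport0 namul0r.
have [hh'|hh'] := pselect (h = h'); last first.
  by rewrite (coef_delta_neq _ hh') transport0 namulr0.
by exfalso; apply: gh; rewrite gg' hh'.
Qed.

Lemma gr_mul_delta (g h : mor G) (r : R (rep g)) (s : R (rep h))
    (gh : gdom g = gcod h) :
  namul (gr_delta r) (gr_delta s) =
  gr_delta (namul (eq_rect _ (fun i => R i : Type) r _ (repr_mor_compl hE gh))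
                  (eq_rect _ (fun i => R i : Type) s _ (repr_mor_compr hE gh))).
Proof.
have transportE (i j : E) (t : R i) (ij : i = j) :
    eq_rect i (fun i => R i : Type) t j ij = transport (R := R) j t.
  by case: _ / ij; rewrite transport_id.
rewrite !transportE; apply: groupoid_ringP => k; rewrite coefM /mul_coef.
have [<-|ghk] := pselect (gcomp g h = k); last first.
  rewrite (coef_delta_neq _ ghk) fsbig1 // => -[g' h'] [/= _ gh'k].
  by apply: mul_delta_term0 => -[gg' hh']; apply: ghk; rewrite gg' hh'.
rewrite coef_delta.
have -> : namul (transport (R := R) (rep (gcomp g h)) r)
                (transport (R := R) (rep (gcomp g h)) s) =
  \sum_(p \in [set (g, h)])
    namul (transport (R := R) (rep (gcomp g h)) (coef (gr_delta r) p.1))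
          (transport (R := R) (rep (gcomp g h)) (coef (gr_delta s) p.2)).
  by rewrite fsbig_set1 [(g, h).1]/fst [(g, h).2]/snd !coef_delta.
apply/esym/fsbig_widen => [_ -> //|[g' h'] [_ /= Np]].
by apply: mul_delta_term0 => ghE; apply: Np; rewrite ghE.
Qed.

Lemma gr_mul_delta0 (g h : mor G) (r : R (rep g)) (s : R (rep h)) :
  gdom g <> gcod h -> namul (gr_delta r) (gr_delta s) = 0.
Proof.
move=> Ngh; apply: groupoid_ringP => k; rewrite coefM.
apply: fsbig1 => -[g' h'] [/= gh' _].
by apply: mul_delta_term0 => -[gg' hh']; apply: Ngh; rewrite gg' hh'.
Qed.

End GroupoidRing.

(* Main.v *)
(* If mor(G) is finite, comparing the ideals of leading coefficients of the
   terms of a chain of ideals of R[G], along an enumeration of mor(G), shows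
   that the chain stops.

   Conversely, ideals of R_e induce ideals of R[G], and so do subsets of
   ob(G), so R_e is artinian and ob(G) is finite. It remains to see that each
   vertex group T is finite. Let V be a minimal one-sided ideal of R_e: it is
   simple over the multiplications by elements of R_e, and X = V[T] inherits
   the descending chain condition for submodules stable under R_e and T. Let
   P be minimal among the submodules not contained in the kernel of the
   augmentation X -> V, and let B be the kernel in P. As X is semisimple over
   R_e and induced from V, there is an endomorphism e of X onto P commuting
   with the augmentation, and 1 - b is onto for every endomorphism b with
   values in B. An endomorphism u with minimal image among those not
   vanishing on P then satisfies u b = 0 on P for all such b. For w = u e and
   the right translations rho_g, this bounds the supports of the maps valued
   in sum_(g in A) rho_g w(X), once precomposed with e, by F A for a fixed
   finite set F. If T were infinite, removing finitely many elements from an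
   infinite A would always shrink this sum, against the chain condition. *)
From HB Require Import structures.
Require Import Defs.
From mathcomp Require Import all_boot all_algebra.
From mathcomp Require Import boolp classical_sets functions cardinality fsbigop.
From mathcomp Require Import finmap monalg.

Set Implicit Arguments.
Unset Strict Implicit.
Unset Printing Implicit Defensive.

Import GRing.Theory.
Local Open Scope classical_set_scope.
Local Open Scope ring_scope.

(** * Chain conditions and additive maps *)

Lemma dcc_minimal (T : Type) (P Q : set T -> Prop) :
  descending_chain_condition P -> (forall I, Q I -> P I) -> (exists I, Q I) ->
  exists2 I, Q I & forall J, Q J -> J `<=` I -> J = I.
Proof.
move=> dcc QP [I0 QI0]; apply: contrapT => nomin.
(* If no member of Q were minimal, dependent choice would give a strictly decreasing chain in Q,
   hence in P. *)
have step (I : {I | Q I}) :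
    {J : {J | Q J} | sval J `<=` sval I & sval J <> sval I}.
  apply: cid2; apply: contrapT => NJ; apply: nomin.
  exists (sval I); first exact: svalP.
  move=> J QJ JI; apply: contrapT => nJI.
  by apply: NJ; exists (exist _ J QJ).
pose c := fix c n := if n is m.+1 then s2val (step (c m)) else exist Q I0 QI0.
have [n|n|N cN] := dcc (fun n => sval (c n)).
- by apply: QP; exact: svalP.
- exact: (s2valP (step (c n))).
- by apply: (s2valP' (step (c N))); exact: cN (leqnSn N).
Qed.

(** Ideals of R_e and submodules of X = V[T] both induce ideals of R[G] in a monotone and injective
    way; this pulls the chain condition back along such a construction. *)
Lemma dcc_transfer (T U : Type) (P : set T -> Prop) (Q : set U -> Prop)
    (f : set T -> set U) :
  (forall I, P I -> Q (f I)) ->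
  (forall I J, I `<=` J -> f I `<=` f J) ->
  (forall I J, P I -> P J -> f I = f J -> I = J) ->
  descending_chain_condition Q -> descending_chain_condition P.
Proof.
move=> PQ fS finj dcc I PI IS.
have [n|n|N cN] := dcc (fun n => f (I n)); [exact: PQ|exact: fS|].
by exists N => n /cN; exact: finj.
Qed.

Section AdditiveMap.
Variables (U V : zmodType) (f : U -> V).
Hypothesis fD : {morph f : x y / x + y}.

Lemma morphD0 : f 0 = 0.
Proof. by apply: (@addIr _ (f 0)); rewrite -fD !add0r. Qed.

Lemma morphDN : {morph f : x / - x}.
Proof. by move=> x; apply: (@addIr _ (f x)); rewrite -fD !addNr morphD0. Qed.

Lemma morphDB : {morph f : x y / x - y}.
Proof. by move=> x y; rewrite fD morphDN. Qed.

Lemma morphD_sum (I : Type) (s : seq I) (P : pred I) (F : I -> U) :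
  f (\sum_(i <- s | P i) F i) = \sum_(i <- s | P i) f (F i).
Proof. exact: (big_morph f fD morphD0). Qed.

End AdditiveMap.

Lemma additive_subgroup_sum (A : zmodType) (I : set A) (K : Type) (s : seq K)
    (P : pred K) (F : K -> A) :
  additive_subgroup I -> (forall k, P k -> I (F k)) ->
  I (\sum_(k <- s | P k) F k).
Proof. by move=> [I0 ID _] IF; elim/big_ind: _. Qed.

Lemma additive_subgroupB (A : zmodType) (I : set A) x y :
  additive_subgroup I -> I x -> I y -> I (x - y).
Proof. by move=> [_ ID IN] Ix Iy; apply: ID => //; exact: IN. Qed.

(** * Modules over a set of operators *)

Section Submodules.
Variable O : Type.
Implicit Types X Y Z : zmodType.

(** The operators form a bare type, without a product: in a non-associative ring a composite of
    multiplications need not be a multiplication. For the action of a ring on itself these are its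
    one-sided ideals. *)
Definition submod X (act : O -> X -> X) (L : set X) : Prop :=
  additive_subgroup L /\ forall o x, L x -> L (act o x).

Definition equivariant X Y (aX : O -> X -> X) (aY : O -> Y -> Y) (f : X -> Y) :=
  {morph f : x y / x + y} /\ forall o x, f (aX o x) = aY o (f x).

Definition simple_mod X (act : O -> X -> X) : Prop :=
  (exists x : X, x <> 0) /\
  forall N, submod act N -> (exists2 x, N x & x <> 0) -> forall x, N x.

Lemma submodT X (act : O -> X -> X) : submod act setT.
Proof. by []. Qed.

Lemma submod_set0 X (act : O -> X -> X) :
  (forall o, {morph act o : x y / x + y}) -> submod act [set 0].
Proof.
move=> aD; split; first by split=> [//|x y -> ->|x ->]; rewrite ?addr0 ?oppr0.
by move=> o x ->; rewrite /= (morphD0 (aD o)).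
Qed.

Lemma submodI X (act : O -> X -> X) (L M : set X) :
  submod act L -> submod act M -> submod act (L `&` M).
Proof.
move=> [[L0 LD LN] Lo] [[M0 MD MN] Mo]; split; first split=> //.
- by move=> x y [Lx Mx] [Ly My]; split; [exact: LD|exact: MD].
- by move=> x [Lx Mx]; split; [exact: LN|exact: MN].
- by move=> o x [Lx Mx]; split; [exact: Lo|exact: Mo].
Qed.

Lemma submod_add X (act : O -> X -> X) (L M : set X) :
  (forall o, {morph act o : x y / x + y}) ->
  submod act L -> submod act M ->
  submod act [set z | exists2 x, L x & exists2 y, M y & z = x + y].
Proof.
move=> aD [[L0 LD LN] Lo] [[M0 MD MN] Mo]; split; first split=> /=.
- by exists 0 => //; exists 0; rewrite ?addr0.
- move=> _ _ [x Lx [y My ->]] [x' Lx' [y' My' ->]].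
  exists (x + x'); first exact: LD.
  by exists (y + y'); [exact: MD|rewrite addrACA].
- move=> _ [x Lx [y My ->]]; exists (- x); first exact: LN.
  by exists (- y); [exact: MN|rewrite opprD].
- move=> o _ [x Lx [y My ->]] /=; exists (act o x); first exact: Lo.
  by exists (act o y); [exact: Mo|rewrite aD].
Qed.

Lemma submod_image X Y (aX : O -> X -> X) (aY : O -> Y -> Y) f (L : set X) :
  equivariant aX aY f -> submod aX L -> submod aY (f @` L).
Proof.
move=> [fD fo] [[L0 LD LN] Lo]; split; first split.
- by exists 0; rewrite ?(morphD0 fD).
- by move=> _ _ [x Lx <-] [y Ly <-]; exists (x + y); rewrite ?fD //; exact: LD.
- by move=> _ [x Lx <-]; exists (- x); rewrite ?(morphDN fD) //; exact: LN.
- by move=> o _ [x Lx <-]; exists (aX o x); rewrite ?fo //; exact: Lo.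
Qed.

Lemma submod_preimage X Y (aX : O -> X -> X) (aY : O -> Y -> Y) f (L : set Y) :
  equivariant aX aY f -> submod aY L -> submod aX (f @^-1` L).
Proof.
move=> [fD fo] [[L0 LD LN] Lo]; split; first split=> /=.
- by rewrite (morphD0 fD).
- by move=> x y Lx Ly; rewrite fD; exact: LD.
- by move=> x Lx; rewrite (morphDN fD); exact: LN.
- by move=> o x Lx; rewrite /= fo; exact: Lo.
Qed.

Lemma equivariant_comp X Y Z (aX : O -> X -> X) (aY : O -> Y -> Y)
    (aZ : O -> Z -> Z) f g :
  equivariant aY aZ f -> equivariant aX aY g -> equivariant aX aZ (f \o g).
Proof.
move=> [fD fo] [gD go]; split=> [x y|o x] /=; first by rewrite gD fD.
by rewrite go fo.
Qed.

Lemma equivariant_id X (aX : O -> X -> X) : equivariant aX aX id.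
Proof. by []. Qed.

Lemma equivariantB X Y (aX : O -> X -> X) (aY : O -> Y -> Y) f g :
  (forall o, {morph aY o : x y / x + y}) ->
  equivariant aX aY f -> equivariant aX aY g ->
  equivariant aX aY (fun x => f x - g x).
Proof.
move=> aD [fD fo] [gD go]; split=> [x y|o x] /=.
  by rewrite fD gD opprD addrACA.
by rewrite fo go (morphDB (aD o)).
Qed.

End Submodules.

(** * Finitely supported functions *)

Section FinitelySupported.
Variables (K : choiceType) (V : zmodType).
Implicit Types (x y : {malg V[K]}) (k : K).

(** For additive [h k], this is the map given by the universal property of a direct sum of copies of
    V. *)
Definition msum (Y : zmodType) (h : K -> V -> Y) x : Y :=
  \sum_(k <- msupp x) h k x@_k.

Lemma malg_ind_add (Y : zmodType) (f g : {malg V[K]} -> Y) :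
  {morph f : x y / x + y} -> {morph g : x y / x + y} ->
  (forall k v, f << v *g k >> = g << v *g k >>) -> f =1 g.
Proof.
move=> fD gD fg x; rewrite (monalgE x) (morphD_sum fD) (morphD_sum gD).
by apply: eq_bigr => k _; exact: fg.
Qed.

Section Msum.
Variables (Y : zmodType) (h : K -> V -> Y).
Hypothesis hD : forall k, {morph h k : v w / v + w}.

Lemma msumw (d : {fset K}) x : (msupp x `<=` d)%fset ->
  msum h x = \sum_(k <- d) h k x@_k.
Proof.
move=> xd; rewrite /msum (big_fset_incl _ xd) // => k _ kx.
by rewrite mcoeff_outdom // (morphD0 (hD k)).
Qed.

Lemma msumD : {morph msum h : x y / x + y}.
Proof.
move=> x y; pose d := (msupp x `|` msupp y)%fset.
rewrite (@msumw d (x + y)) ?msuppD_le // (@msumw d x) ?fsubsetUl //.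
rewrite (@msumw d y) ?fsubsetUr // -big_split /=.
by apply: eq_bigr => k _; rewrite mcoeffD hD.
Qed.

Lemma msumU k v : msum h << v *g k >> = h k v.
Proof.
by rewrite (msumw msuppU_le) big_seq_fset1 mcoeffUU.
Qed.

End Msum.

Lemma malg_neq0 x : x <> 0 -> exists k, x@_k <> 0.
Proof.
move=> x0; apply: contrapT => Nk; apply: x0; apply/malgP => k; rewrite mcoeff0.
by apply: contrapT => xk; apply: Nk; exists k.
Qed.

Lemma mcoeff_addm k : {morph (fun x => x@_k) : x y / x + y}.
Proof. by move=> x y; rewrite mcoeffD. Qed.

End FinitelySupported.

(** * Finitely supported functions with values in a simple module *)

Section SimpleModule.
Variables (O : Type) (V : zmodType) (act : O -> V -> V).
Hypothesis actD : forall o, {morph act o : v w / v + w}.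
Hypothesis Vsimple : simple_mod act.

Let subV (N : set V) v : submod act N -> N v -> v <> 0 -> forall w, N w.
Proof. by case: Vsimple => _ subT sN Nv v0; apply: subT => //; exists v. Qed.

Section Coordinatewise.
Variable K : choiceType.
Local Notation X := {malg V[K]}.

Definition cact (o : O) : X -> X := msum (fun k v => << act o v *g k >> : X).

Let cact_aux o k : {morph (fun v : V => << act o v *g k >> : X) : v w / v + w}.
Proof. by move=> v w; rewrite actD monalgUD. Qed.

Lemma cactD o : {morph cact o : x y / x + y}.
Proof. exact: msumD (cact_aux o). Qed.

Lemma cactU o k v : cact o << v *g k >> = << act o v *g k >>.
Proof. exact: msumU (cact_aux o) _ _. Qed.

Lemma mcoeff_cact o (x : X) k : (cact o x)@_k = act o x@_k.
Proof.
apply: (malg_ind_add (f := fun x => (cact o x)@_k)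
                     (g := fun x => act o x@_k)) => [y z|y z|l v].
- by rewrite cactD mcoeffD.
- by rewrite mcoeffD actD.
- rewrite cactU !mcoeffU; case: eqP => _; rewrite ?mulr1n //.
  by rewrite !mulr0n (morphD0 (actD o)).
Qed.

Lemma mcoeff_equivariant k : equivariant cact act (fun x : X => x@_k).
Proof. by split=> [x y|o x]; rewrite ?mcoeffD ?mcoeff_cact. Qed.

Lemma mkmalgU_equivariant k : equivariant act cact (fun v => << v *g k >> : X).
Proof. by split=> [x y|o x]; rewrite ?monalgUD ?cactU. Qed.

Lemma submod_msupp (d : {fset K}) :
  submod cact [set x : X | (msupp x `<=` d)%fset].
Proof.
split; first split=> /=.
- by rewrite msupp0 fsub0set.
- move=> x y xd yd; apply: fsubset_trans (msuppD_le _ _) _.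
  by rewrite fsubUset xd.
- by move=> x xd; rewrite msuppN.
move=> o x xd /=; apply/fsubsetP => l; rewrite -mcoeff_neq0 mcoeff_cact => ol.
apply: (fsubsetP xd); rewrite -mcoeff_neq0; apply: contra ol => /eqP ->.
by rewrite (morphD0 (actD o)).
Qed.

(* A pair (v, z) with v <> 0 and z of minimal support size generates the graph:
   if some nonzero (0, y) had support inside that of z, the coordinates at k of
   such y would fill V, and one of them could be used to cancel z at k. *)
Lemma equivariant_selection (r : set (V * X)) :
  submod (fun o p => (act o p.1, cact o p.2)) r ->
  (forall v, exists x, r (v, x)) ->
  exists2 c, equivariant act cact c & forall v, r (v, c v).
Proof.
move=> sr rtot; have [[r0 rD rN] ro] := sr.
have rB v x w y : r (v, x) -> r (w, y) -> r (v - w, x - y).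
  by move=> /rD rvx /rN; exact: rvx.
pose good n := `[< exists p, [/\ r p, p.1 <> 0 & #|` msupp p.2| = n] >].
have exgood : exists n, good n.
  have [[v v0] _] := Vsimple; have [x rvx] := rtot v.
  by exists #|` msupp x|; apply/asboolP; exists (v, x).
case: (ex_minnP exgood) => n /asboolP[[v0 z] [/= rvz v0N zn]] nmin.
pose S := [set x : X | (msupp x `<=` msupp z)%fset].
have sS : submod cact S by exact: submod_msupp.
have uniq0 y : r (0, y) -> S y -> y = 0.
  move=> ry yz; apply: contrapT => yN.
  have [k yk] := malg_neq0 yN.
  have kz : k \in msupp z.
    by apply: (fsubsetP yz); rewrite -mcoeff_neq0; apply/eqP.
  pose N := (fun x : X => x@_k) @` ((fun x => (0, x)) @^-1` r `&` S).
  have sN : submod act N.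
    apply: submod_image (mcoeff_equivariant k) (submodI _ sS).
    apply: submod_preimage sr; split=> [a b|o a].
      by congr (_, _); rewrite /= addr0.
    by rewrite /= (morphD0 (actD o)).
  have [|a [ra az] azk] := subV sN _ yk (z@_k); first by exists y.
  have : (n <= #|` msupp (z - a)|)%N.
    apply: nmin; apply/asboolP; exists (v0, z - a); split=> //.
    by have := rB _ _ _ _ rvz ra; rewrite subr0.
  rewrite leqNgt -zn => /negP; apply; apply: fproper_ltn_card.
  rewrite fproperE; apply/andP; split; last first.
    apply/negP => /fsubsetP/(_ k kz).
    by rewrite -mcoeff_neq0 mcoeffB azk subrr eqxx.
  by apply: fsubset_trans (msuppB_le _ _) _; rewrite fsubUset fsubset_refl.
(* The v related to some x supported within z form a submodule of V containing [v0], hence all of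
   V. *)
have ex v : exists x, r (v, x) /\ S x.
  suff: (fst @` (r `&` snd @^-1` S)) v by move=> [[w x] [rwx Sx] <-]; exists x.
  apply: (subV (v := v0)) => //; last first.
    by exists (v0, z) => //; split; last exact: fsubset_refl.
  apply: submod_image
    (_ : equivariant (fun o p => (act o p.1, cact o p.2)) _ _) _ => //.
  apply: submodI sr (submod_preimage _ sS); exact: conj.
have unq v x y : r (v, x) -> r (v, y) -> S x -> S y -> x = y.
  move=> rx ry xz yz; apply/eqP; rewrite -subr_eq0; apply/eqP/uniq0.
    by have := rB _ _ _ _ rx ry; rewrite subrr.
  exact: additive_subgroupB sS.1 _ _.
have [c cP] := choice ex.
have cr v := (cP v).1; have cz v := (cP v).2.
have [[S0 SD SN] So] := sS.
exists c => //; split=> [v w|o v]; apply: unq (cr _) _ (cz _) _.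
- exact: (rD _ _ (cr v) (cr w)).
- exact: SD.
- exact: (ro o _ (cr v)).
- exact: So.
Qed.

(** This stands in for the semisimplicity of X over O: a selection from the relation f x = t v, with
    x in L, is the lift. *)
Lemma equivariant_lift (Y : zmodType) (aY : O -> Y -> Y)
    (L : set X) (f : X -> Y) (t : V -> Y) :
  submod cact L -> equivariant cact aY f -> equivariant act aY t ->
  (forall v, (f @` L) (t v)) ->
  exists2 c, equivariant act cact c & forall v, L (c v) /\ f (c v) = t v.
Proof.
move=> [[L0 LD LN] Lo] [fD fo] [tD to] ft.
have [||c ch cP] := @equivariant_selection
  [set p | L p.2 /\ f p.2 = t p.1]; last by exists c.
- split; first split=> /=.
  + by rewrite (morphD0 fD) (morphD0 tD).
  + by move=> a b [La fa] [Lb fb]; split; [exact: LD|rewrite fD tD fa fb].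
  + move=> a [La fa]; split; first exact: LN.
    by rewrite (morphDN fD) (morphDN tD) fa.
  + by move=> o a [La fa]; split; [exact: Lo|rewrite /= fo to fa].
- by move=> v; have [x Lx fx] := ft v; exists x.
Qed.

(** For a fixed nonzero v, the w with supp (t w) inside supp (t v) form a submodule containing v, so
    all of V by simplicity. *)
Lemma finite_image_support (t : V -> X) :
  equivariant act cact t ->
  exists2 F : set K, finite_set F & forall v k, (t v)@_k <> 0 -> F k.
Proof.
move=> eqt; have [[v v0] _] := Vsimple.
exists [set` msupp (t v)]; first exact: finite_fset.
move=> w k; suff: (msupp (t w) `<=` msupp (t v))%fset.
  by move=> /fsubsetP wv /eqP; rewrite mcoeff_neq0 => /wv.
apply: (subV (submod_preimage eqt (submod_msupp (msupp (t v)))) _ v0 w).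
exact: fsubset_refl.
Qed.

End Coordinatewise.
End SimpleModule.

(** * Modules induced to a group *)

Section GroupModule.
Variables (O : Type) (V : zmodType) (act : O -> V -> V).
Hypothesis actD : forall o, {morph act o : v w / v + w}.
Hypothesis Vsimple : simple_mod act.
Variable T : groupType.
Local Notation X := {malg V[T]}.
Local Notation cact := (@cact O V act T).

Definition ltrans (g : T) : X -> X :=
  msum (fun k v => << v *g (g * k)%g >> : X).
Definition rtrans (g : T) : X -> X :=
  msum (fun k v => << v *g (k * g)%g >> : X).
Definition augment : X -> V := msum (fun (_ : T) v => v).
Definition gact (o : O + T) : X -> X :=
  match o with inl a => cact a | inr g => ltrans g end.

Let trans_aux (f : T -> T) k :
  {morph (fun v : V => << v *g f k >> : X) : v w / v + w}.
Proof. by move=> v w; rewrite monalgUD. Qed.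

Lemma ltransD g : {morph ltrans g : x y / x + y}.
Proof. exact: msumD (trans_aux (fun k => g * k)%g). Qed.

Lemma rtransD g : {morph rtrans g : x y / x + y}.
Proof. exact: msumD (trans_aux (fun k => k * g)%g). Qed.

Lemma augmentD : {morph augment : x y / x + y}.
Proof. exact: msumD. Qed.

Lemma ltransU g k v : ltrans g << v *g k >> = << v *g (g * k)%g >>.
Proof. exact: msumU (trans_aux (fun k => g * k)%g) _ _. Qed.

Lemma rtransU g k v : rtrans g << v *g k >> = << v *g (k * g)%g >>.
Proof. exact: msumU (trans_aux (fun k => k * g)%g) _ _. Qed.

Lemma augmentU k v : augment << v *g k >> = v.
Proof. exact: msumU. Qed.

Lemma gactD o : {morph gact o : x y / x + y}.
Proof. by case: o => [a|g]; [exact: cactD|exact: ltransD]. Qed.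

Lemma mcoeff_ltrans g (x : X) k : (ltrans g x)@_k = x@_(g^-1 * k)%g.
Proof.
apply: (malg_ind_add (f := fun x => (ltrans g x)@_k)
    (g := fun x => x@_(g^-1 * k)%g)) => [y z|y z|l v].
- by rewrite ltransD mcoeffD.
- by rewrite mcoeffD.
- by rewrite ltransU !mcoeffU -[l == _](inj_eq (mulgI g)) mulVKg.
Qed.

Lemma mcoeff_rtrans g (x : X) k : (rtrans g x)@_k = x@_(k * g^-1)%g.
Proof.
apply: (malg_ind_add (f := fun x => (rtrans g x)@_k)
    (g := fun x => x@_(k * g^-1)%g)) => [y z|y z|l v].
- by rewrite rtransD mcoeffD.
- by rewrite mcoeffD.
- by rewrite rtransU !mcoeffU -[l == _](inj_eq (mulIg g)) mulgVK.
Qed.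

Lemma augment_cact a x : augment (cact a x) = act a (augment x).
Proof.
apply: (malg_ind_add (f := fun x => augment (cact a x))
    (g := fun x => act a (augment x))) => [y z|y z|l v].
- by rewrite (cactD actD) augmentD.
- by rewrite augmentD actD.
- by rewrite (cactU actD) !augmentU.
Qed.

Lemma augment_ltrans g x : augment (ltrans g x) = augment x.
Proof.
apply: (malg_ind_add (f := fun x => augment (ltrans g x))) => [y z|y z|l v].
- by rewrite ltransD augmentD.
- by rewrite augmentD.
- by rewrite ltransU !augmentU.
Qed.

Lemma augment_equivariant : equivariant cact act augment.
Proof. by split; [exact: augmentD|exact: augment_cact]. Qed.

Lemma rtrans_equivariant g : equivariant gact gact (rtrans g).
Proof.
split=> [|[a|h] x]; first exact: rtransD; apply/malgP => k /=.
- by rewrite mcoeff_rtrans !mcoeff_cact // mcoeff_rtrans.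
- by rewrite mcoeff_rtrans !mcoeff_ltrans mcoeff_rtrans mulgA.
Qed.

Lemma submod_cact (L : set X) : submod gact L -> submod cact L.
Proof. by move=> [Lg Lo]; split=> // o x; exact: (Lo (inl o)). Qed.

Lemma equivariant_cact (f : X -> X) :
  equivariant gact gact f -> equivariant cact cact f.
Proof. by move=> [fD fo]; split=> // o x; exact: (fo (inl o)). Qed.

(* {malg V[T]} is the module induced from V: a map V -> X compatible with O
   extends uniquely to an endomorphism of X commuting with left translations. *)
Definition extend (t : V -> X) : X -> X := msum (fun k v => ltrans k (t v)).

Section Extend.
Variables (t : V -> X) (eqt : equivariant act cact t).

Let extend_aux k : {morph (fun v => ltrans k (t v)) : v w / v + w}.
Proof. by move=> v w; rewrite eqt.1 ltransD. Qed.

Lemma extendU k v : extend t << v *g k >> = ltrans k (t v).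
Proof. exact: msumU extend_aux _ _. Qed.

Lemma ltrans_cact g a x : ltrans g (cact a x) = cact a (ltrans g x).
Proof.
by apply/malgP => k; rewrite mcoeff_cact // !mcoeff_ltrans mcoeff_cact.
Qed.

Lemma ltransM g h x : ltrans g (ltrans h x) = ltrans (g * h)%g x.
Proof. by apply/malgP => k; rewrite !mcoeff_ltrans invgM mulgA. Qed.

Lemma ltrans1 x : ltrans 1%g x = x.
Proof. by apply/malgP => k; rewrite mcoeff_ltrans invg1 mul1g. Qed.

Lemma extend_equivariant : equivariant gact gact (extend t).
Proof.
have eD : {morph extend t : x y / x + y} by exact: msumD extend_aux.
split=> // o x; apply: (malg_ind_add (f := fun x => extend t (gact o x))
    (g := fun x => gact o (extend t x))) => [y z|y z|k v].
- by rewrite gactD eD.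
- by rewrite eD gactD.
case: o => [a|g] /=.
- by rewrite (cactU actD) !extendU eqt.2 ltrans_cact.
- by rewrite ltransU !extendU ltransM.
Qed.

Lemma extend_sub (L : set X) x :
  submod gact L -> (forall v, L (t v)) -> L (extend t x).
Proof.
move=> [Lg Lo] Lt; apply: additive_subgroup_sum => // k _.
exact: (Lo (inr k)).
Qed.

End Extend.

Lemma equivariant_ext (f g : X -> X) :
  equivariant gact gact f -> equivariant gact gact g ->
  (forall v, f << v *g 1%g >> = g << v *g 1%g >>) -> f =1 g.
Proof.
move=> [fD fo] [gD go] fg; apply: malg_ind_add => // k v.
by rewrite -[k]mulg1 -ltransU (fo (inr k)) (go (inr k)) fg.
Qed.

Lemma unit_equivariant (f : X -> X) : equivariant gact gact f ->
  equivariant act cact (fun v => f << v *g 1%g >>).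
Proof.
move=> /equivariant_cact ef; apply: equivariant_comp ef _.
exact: mkmalgU_equivariant.
Qed.

Lemma extend_unit (f : X -> X) : equivariant gact gact f ->
  extend (fun v => f << v *g 1%g >>) =1 f.
Proof.
move=> ef; have e1 := unit_equivariant ef.
apply: equivariant_ext => // [|v]; first exact: extend_equivariant.
by rewrite extendU // ltrans1.
Qed.

(** As X is induced from V, it is enough to lift h over O on the copy of V at 1 and to extend the
    result. *)
Lemma lift_endo (L : set X) (f h : X -> X) :
  submod gact L -> equivariant gact gact f -> equivariant gact gact h ->
  (forall x, (f @` L) (h x)) ->
  exists c, [/\ equivariant gact gact c, forall x, L (c x) & f \o c =1 h].
Proof.
move=> sL ef eh fLh.
have [c ec cP] := equivariant_lift actD Vsimple (submod_cact sL)
  (equivariant_cact ef) (unit_equivariant eh) (fun v => fLh _).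
exists (extend c); split; first exact: extend_equivariant.
- by move=> x; apply: extend_sub => // v; case: (cP v).
- apply: equivariant_ext => // [|v].
    exact: equivariant_comp ef (extend_equivariant ec).
  by rewrite /= extendU // ltrans1; case: (cP v).
Qed.

End GroupModule.

(** * Finiteness of the group from the chain condition *)

Section Artinian.
Variables (O : Type) (V : zmodType) (act : O -> V -> V).
Hypothesis actD : forall o, {morph act o : v w / v + w}.
Hypothesis Vsimple : simple_mod act.
Variable T : groupType.
Local Notation X := {malg V[T]}.
Local Notation gact := (@gact O V act T).
Local Notation cact := (@cact O V act T).
Local Notation eps := (@augment V T).
Local Notation endo := (equivariant gact gact).
Hypothesis dccX : descending_chain_condition (submod gact).

Let gactD' : forall o, {morph gact o : x y / x + y} := @gactD O V act actD T.

Lemma augment_full (L : set X) (x : X) : submod gact L -> L x -> eps x <> 0 ->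
  forall v, (eps @` L) v.
Proof.
move=> sL Lx x0; case: (Vsimple) => _ subV.
apply: (subV (eps @` L)); last by exists (eps x) => //; exists x.
exact: submod_image (@augment_equivariant O V act actD T) (submod_cact sL).
Qed.

Lemma exists_minimal_augmented : exists P : set X,
  [/\ submod gact P, exists2 x, P x & eps x <> 0 &
   forall L x, submod gact L -> L `<=` P -> L x -> eps x <> 0 -> L = P].
Proof.
have [[v v0] _] := Vsimple.
have [I []//||P [sP [x Px x0]] Pmin] := dcc_minimal (P := submod gact)
    (Q := fun L => submod gact L /\ exists2 x, L x & eps x <> 0) dccX.
- exists setT; split; first exact: submodT.
  by exists << v *g 1%g >>; rewrite ?augmentU.
- exists P; split=> //; first by exists x.
  by move=> L y sL LP Ly y0; apply: Pmin => //; split=> //; exists y.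
Qed.

(** The identity of V lifts through the augmentation on P, and the lift extends to X. The result
    need not be idempotent. *)
Lemma exists_projection (P : set X) x : submod gact P -> P x -> eps x <> 0 ->
  exists e, [/\ endo e, forall x, P (e x) & eps \o e =1 eps].
Proof.
move=> sP Px x0.
have [c ec cP] := equivariant_lift actD Vsimple (submod_cact sP)
  (@augment_equivariant O V act actD T) (@equivariant_id _ _ act)
  (augment_full sP Px x0).
exists (extend c); split; first exact: extend_equivariant.
  by move=> y; apply: (extend_sub _ sP) => v; case: (cP v).
have eD := (extend_equivariant actD ec).1.
apply: malg_ind_add => [y z|y z|k v] /=.
- by rewrite eD augmentD.
- by rewrite augmentD.
- by rewrite (extendU ec) augment_ltrans augmentU; case: (cP v).
Qed.

Section Minimal.
Variable P : set X.
Hypothesis sP : submod gact P.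
Hypothesis Pmin : forall L x,
  submod gact L -> L `<=` P -> L x -> eps x <> 0 -> L = P.
Variables (x0 : X) (Px0 : P x0) (x0N : eps x0 <> 0).

Let B := P `&` [set x | eps x = 0].

(* The kernel B of the augmentation on P is superfluous: a submodule L with
   L + B = X meets P outside B, hence contains P by minimality. *)
Lemma id_sub_surj b y : endo b -> (forall x, B (b x)) -> exists x, x - b x = y.
Proof.
move=> eb Bb; pose L := (fun x => x - b x) @` setT.
have sL : submod gact L.
  apply: submod_image (submodT _).
  exact: equivariantB gactD' (equivariant_id _) eb.
have PL : L `&` P = P.
  (* As b x0 lies in B, the element x0 - b x0 of L is in P and has the same augmentation as x0. *)
  apply: (Pmin (x := x0 - b x0)) => //; first exact: submodI.
  - split; first by exists x0.
    by apply: additive_subgroupB sP.1 Px0 _; case: (Bb x0).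
  - rewrite (morphDB (@augmentD V T)); have [_ /= ->] := Bb x0.
    by rewrite subr0.
have [x _ <-] : L y; last by exists x.
have [Lby _] : (L `&` P) (b y) by rewrite PL; case: (Bb y).
have [[_ LD _] _] := sL.
by rewrite -[y](subrK (b y)); apply: LD => //; exists y.
Qed.

(** Take u of minimal image. If u b were nonzero on P, it would have the same image as u, so u = u b
    c for some c, by lifting. Then u kills the image of 1 - b c, which is all of X, against u <>
    0. *)
Lemma exists_minimal_image : exists u, [/\ endo u, exists2 x, P x & u x <> 0 &
  forall b, endo b -> (forall x, B (b x)) -> forall x, P x -> u (b x) = 0].
Proof.
have [I||_ [u [eu uP ->]] umin] := dcc_minimal (P := submod gact)
    (Q := fun L => exists u,
       [/\ endo u, exists2 x, P x & u x <> 0 & L = range u]) dccX.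
- move=> [u [eu _ ->]]; exact: submod_image eu (submodT _).
- exists (range id), id; split=> //; exists x0 => // x00.
  by apply: x0N; rewrite x00 (morphD0 (@augmentD V T)).
exists u; split=> // b eb Bb x Px; apply: contrapT => ubx.
have ub : endo (u \o b) by exact: equivariant_comp eu eb.
have uT : range (u \o b) = range u.
  apply: umin; first by exists (u \o b); split=> //; exists x.
  by move=> _ [y _ <-]; exists (b y).
have [|c [ec _ cP]] := lift_endo actD Vsimple (submodT gact) ub eu.
  by move=> y; rewrite uT; exists y.
have ebc : endo (b \o c) by exact: equivariant_comp eb ec.
case: uP => y _; apply; have [|z <-] := id_sub_surj y ebc.
  by move=> z; exact: Bb.
by rewrite (morphDB eu.1) -(cP z) /= subrr.
Qed.

End Minimal.

Section RightTranslates.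
Variable w : X -> X.
Hypothesis ew : endo w.

(** Sums of the images of rho_g w are indexed by lists, so that one translate can be split off at a
    time by induction. *)
Fixpoint rsum (s : seq T) : set X :=
  if s is g :: s' then
    [set z | exists2 x, range (rtrans g \o w) x &
             exists2 y, rsum s' y & z = x + y]
  else [set 0].

Lemma rsum_submod s : submod gact (rsum s).
Proof.
elim: s => [|g s IHs] /=; first exact: submod_set0.
apply: submod_add => //; apply: submod_image (submodT _).
exact: equivariant_comp (rtrans_equivariant actD g) ew.
Qed.

Lemma rsum_cat s s' x y : rsum s x -> rsum s' y -> rsum (s ++ s') (x + y).
Proof.
elim: s x => [|g s IHs] x /=; first by move=> ->; rewrite add0r.
move=> [z gz [t st ->]] s'y; exists z => //; exists (t + y); rewrite ?addrA //.
exact: IHs.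
Qed.

Definition rspan (A : set T) : set X :=
  [set x | exists2 s, (forall g, g \in s -> A g) & rsum s x].

Lemma rspan_submod A : submod gact (rspan A).
Proof.
split; first split.
- by exists [::].
- move=> x y [s sA sx] [s' sA' sy]; exists (s ++ s'); last exact: rsum_cat.
  by move=> g; rewrite mem_cat => /orP[/sA|/sA'].
- move=> x [s sA sx]; exists s => //.
  by case: (rsum_submod s) => -[_ _ sN] _; exact: sN.
- by move=> o x [s sA sx]; exists s => //; case: (rsum_submod s) => _; apply.
Qed.

(** By simplicity of V, a finite list that serves one nonzero vector serves all of them. *)
Lemma rspan_simple A (t : V -> X) : equivariant act cact t ->
  (exists2 v, rspan A (t v) & v <> 0) ->
  exists2 s, (forall g, g \in s -> A g) & forall v, rsum s (t v).
Proof.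
move=> et [v [s sA sv] v0]; exists s => //; case: (Vsimple) => _ subT.
apply: (subT (t @^-1` rsum s)); last by exists v.
exact: submod_preimage et (submod_cact (rsum_submod s)).
Qed.

End RightTranslates.

Theorem dcc_group_finite : finite_set [set: T].
Proof.
apply: contrapT => Tinf.
have [P [sP [x0 Px0 x0N] Pmin]] := exists_minimal_augmented.
have [e [ee Pe epse]] := exists_projection sP Px0 x0N.
have [u [eu [p Pp up] uB]] := exists_minimal_image sP Pmin Px0 x0N.
pose w := u \o e; have ew : endo w by exact: equivariant_comp eu ee.
pose unit v : X := << v *g 1%g >>.
(* e \o e maps onto P, hence u \o e \o e is nonzero because u is so on P. *)
have eeP : range (e \o e) = P.
  apply: (Pmin _ (e (e x0))).
  - by apply: submod_image (submodT _); exact: (equivariant_comp ee ee).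
  - by move=> _ [y _ <-]; exact: Pe.
  - by exists x0.
  - by rewrite -[eps _]/((eps \o e) _) epse -[eps _]/((eps \o e) _) epse.
have [v0 wev0] : exists v, w (e (unit v)) <> 0.
  apply: contrapT => we0; apply: up.
  have [y _ <-] : (range (e \o e)) p by rewrite eeP.
  have ewe : endo (w \o e) by exact: equivariant_comp ew ee.
  have zD : endo (fun=> 0).
    by split=> [a b|o x]; rewrite ?addr0 // (morphD0 (gactD' o)).
  apply: (equivariant_ext ewe zD _ y) => v /=.
  by apply: contrapT => wev; apply: we0; exists v.
have [F1 fF1 eF1] := finite_image_support actD Vsimple
    (unit_equivariant actD ee).
have [F2 fF2 wF2] := finite_image_support actD Vsimple
    (unit_equivariant actD ew).
pose F := (fun p => p.1 * p.2)%g @` (F1 `*` F2).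
have fF : finite_set F by apply: finite_image; exact: finite_setX.
(* w y is the sum over l in supp y of the left translates by l of w (y_l delta_1), whose supports
   lie in [F2]. *)
have suppw y : (forall k, y@_k <> 0 -> F1 k) -> forall k, (w y)@_k <> 0 -> F k.
  move=> yF1 k; rewrite -(extend_unit actD ew) /extend /msum => wk.
  apply: contrapT => NFk; apply: wk.
  rewrite (morphD_sum (mcoeff_addm k)) big_seq big1 // => l ly.
  apply: contrapT; rewrite mcoeff_ltrans => /wF2 kl; apply: NFk.
  exists (l, l^-1 * k)%g; last by rewrite /= mulVKg.
  by split=> //; apply: yF1; apply/eqP; rewrite mcoeff_neq0.
(* Modulo maps into the kernel of the augmentation on P, which u kills on P,
   e \o extend c agrees with e \o extend d where d is valued in V delta_1; the
   latter does not enlarge supports. *)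
have claim s (t : V -> X) : equivariant act cact t ->
    (forall v, rsum w s (t v)) -> forall v k, (extend t (e (unit v)))@_k <> 0 ->
    exists2 g, g \in s & F (k * g^-1)%g.
  elim: s t => [|g s IHs] t et st v k.
    rewrite /extend /msum big1 ?mcoeff0 // => l _.
    by rewrite (st _ : _ = 0) (morphD0 (@ltransD V T l)).
  (* Choose equivariantly the summand [t1 v] of t v in the translate by g; the remainder [t2] takes
     values in [rsum w s]. Induction applies unless the coefficient at k comes from [t1] alone. *)
  move=> tk; have [||c ec cP] := @equivariant_selection _ _ _ actD Vsimple T
      [set q | rsum w s (t q.1 - rtrans g (w q.2))].
  - apply: (submod_preimage (f := fun q => t q.1 - rtrans g (w q.2))
      (aY := cact)); last exact: submod_cact (rsum_submod ew s).
    split=> [q q'|o q] /=.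
      by rewrite et.1 ew.1 rtransD opprD addrACA.
    rewrite et.2 (equivariant_cact ew).2.
    rewrite (equivariant_cact (rtrans_equivariant actD g)).2.
    by rewrite -(morphDB (cactD actD o)).
  - move=> v'; have [_ [y _ <-] [z sz tv']] := st v'; exists y.
    by rewrite /= tv' addrAC subrr add0r.
  pose t1 v := rtrans g (w (c v)); pose t2 v := t v - t1 v.
  have et1 : equivariant act cact t1.
    apply: equivariant_comp (equivariant_cact (rtrans_equivariant actD g)) _.
    exact: equivariant_comp (equivariant_cact ew) ec.
  have et2 : equivariant act cact t2.
    by apply: equivariantB et et1 => o; exact: cactD.
  have tE x : extend t x = extend t1 x + extend t2 x.
    rewrite /extend /msum -big_split /=; apply: eq_bigr => l _.
    by rewrite -ltransD addrC subrK.
  have [t2k|t2k] := pselect ((extend t2 (e (unit v)))@_k = 0); last first.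
    have [h hs Fh] := IHs t2 et2 cP v k t2k.
    by exists h; rewrite ?inE ?hs ?orbT.
  exists g; rewrite ?inE ?eqxx //; apply: contrapT => NF; apply: tk.
  rewrite tE mcoeffD t2k addr0.
  have eec := extend_equivariant actD ec.
  have -> : extend t1 (e (unit v)) = rtrans g (w (extend c (e (unit v)))).
    apply: (equivariant_ext (act := act) (f := extend t1)
      (g := fun x => rtrans g (w (extend c x)))).
    - exact: extend_equivariant.
    - apply: equivariant_comp (rtrans_equivariant actD g) _.
      exact: equivariant_comp ew eec.
    - move=> v'; rewrite (extendU et1) (extendU ec).
      by rewrite !ltrans1.
  pose d v' : X := << eps (c v') *g 1%g >>.
  have ed : equivariant act cact d.
    apply: equivariant_comp (mkmalgU_equivariant actD _) _.
    exact: equivariant_comp (augment_equivariant actD T) ec.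
  have eed := extend_equivariant actD ed.
  have epscd x : eps (extend c x) = eps (extend d x).
    apply: (malg_ind_add (f := fun x => eps (extend c x))
      (g := fun x => eps (extend d x))) => [y z|y z|l v'].
    - by rewrite eec.1 augmentD.
    - by rewrite eed.1 augmentD.
    - by rewrite (extendU ec) (extendU ed) !augment_ltrans augmentU.
  (* Since e preserves augmentations and maps into P, e composed with [extend c] and with [extend d]
     differ by a map into B; u kills its values on P, where e (unit v) lies. *)
  have -> : w (extend c (e (unit v))) = w (extend d (e (unit v))).
    apply/eqP; rewrite -subr_eq0 -(morphDB eu.1); apply/eqP.
    apply: (uB (fun x => e (extend c x) - e (extend d x))) => //.
      apply: (equivariantB gactD'); first exact: equivariant_comp ee eec.
      exact: equivariant_comp ee eed.
    move=> x; split; first exact: additive_subgroupB sP.1 (Pe _) (Pe _).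
    rewrite /= (morphDB (@augmentD V T)).
    rewrite -![eps (e _)]/((eps \o e) _) !epse.
    by rewrite epscd subrr.
  rewrite mcoeff_rtrans; apply: contrapT => /suppw FF; apply: NF.
  apply: FF => l.
  (* [extend d] acts coefficient by coefficient, so its value at e (unit v) is still supported in
     [F1]. *)
  have -> : (extend d (e (unit v)))@_l = eps (c (e (unit v))@_l).
    apply: (malg_ind_add (f := fun x => (extend d x)@_l)
      (g := fun x : X => eps (c x@_l))) => [y z|y z|l' v'].
    - by rewrite eed.1 mcoeffD.
    - by rewrite mcoeffD ec.1 augmentD.
    rewrite (extendU ed) ltransU mulg1 !mcoeffU; case: eqP => _ //.
    by rewrite !mulr0n (morphD0 ec.1) (morphD0 (@augmentD V T)).
  move=> cl; apply: (eF1 v) => el; apply: cl.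
  by rewrite el (morphD0 ec.1) (morphD0 (@augmentD V T)).
have [I||_ [A Ainf ->] Amin] := dcc_minimal (P := submod gact)
    (Q := fun L => exists2 A, infinite_set A & L = rspan w A) dccX.
- by move=> [A _ ->]; exact: rspan_submod.
- by exists (rspan w setT), setT.
have [g Ag] : exists g, A g.
  apply: contrapT => NA; apply: Ainf; rewrite (_ : A = set0) ?finite_set0 //.
  by apply/seteqP; split=> // g Ag; apply: NA; exists g.
(* This is the finite set of h such that F h meets F g. By minimality the span survives its removal
   from A, so rho_g w (unit v) is a sum of translates by elements h outside [bad]. The claim then
   puts a point k g of F g in some F h, a contradiction. *)
pose bad := (fun q => q.1^-1 * (q.2 * g))%g @` (F `*` F).
have AA' : rspan w (A `\` bad) = rspan w A.
  apply: Amin; last by move=> x [s sA sx]; exists s => // h /sA[].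
  exists (A `\` bad) => //; apply: infinite_setD => //.
  by apply: finite_image; exact: finite_setX.
pose t v := rtrans g (w (unit v)).
have ewg : endo (rtrans g \o w).
  exact: equivariant_comp (rtrans_equivariant actD g) ew.
have et : equivariant act cact t := unit_equivariant actD ewg.
have [|s sA st] := @rspan_simple w ew (A `\` bad) t et.
  have [[v v0N] _] := Vsimple; exists v => //; rewrite AA'.
  exists [:: g]; first by move=> h; rewrite inE => /eqP ->.
  by exists (t v); [exists (unit v)|exists 0; rewrite ?addr0].
have [k wk] := malg_neq0 wev0.
have [|h hs Fh] := claim s t et st v0 (k * g)%g.
  by rewrite (extend_unit actD ewg) /= mcoeff_rtrans mulgK.
have Fk : F k by apply: suppw wk => l; exact: eF1.
have [_ []] := sA h hs; exists (k * g * h^-1, k)%g => //=.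
by rewrite invgM invgK -mulgA mulVg mulg1.
Qed.

End Artinian.

(** * Groupoids *)

Section GroupoidTheory.
Variable G : groupoid.
Implicit Types g h k : mor G.

Definition ginv g : mor G := sval (cid (mor_iso g)).

Lemma gdom_inv g : gdom (ginv g) = gcod g.
Proof. by rewrite /ginv; case: cid => h []. Qed.

Lemma gcod_inv g : gcod (ginv g) = gdom g.
Proof. by rewrite /ginv; case: cid => h []. Qed.

Lemma gcompV g : gcomp g (ginv g) = idm (gcod g).
Proof. by rewrite /ginv; case: cid => h []. Qed.

Lemma gcompVl g : gcomp (ginv g) g = idm (gdom g).
Proof. by rewrite /ginv; case: cid => h []. Qed.

Lemma gcompVK g k : gcod g = gcod k -> gcomp g (gcomp (ginv g) k) = k.
Proof.
by move=> gk; rewrite gcompA ?gdom_inv ?gcod_inv // gcompV gk gcomp_idl.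
Qed.

Lemma gcompKV g k : gdom g = gcod k -> gcomp (ginv g) (gcomp g k) = k.
Proof.
by move=> gk; rewrite gcompA ?gdom_inv ?gcod_inv // gcompVl gk gcomp_idl.
Qed.

Lemma gcomp_idm f k : gcod k = f -> gcomp (idm f) k = k.
Proof. by move=> <-; exact: gcomp_idl. Qed.

Lemma gcomp_invid f k : gcod k = f -> gcomp (ginv (idm f)) k = k.
Proof.
by move=> kf; rewrite -{1}(gcomp_idm kf) gcompKV // gdom_idm.
Qed.

End GroupoidTheory.

(* [sided false] is the opposite groupoid; it turns right ideals of the groupoid
   ring into left ones. *)
Section Sided.
Variables (b : bool) (G : groupoid).

Let sdom : mor G -> ob G := if b then gdom else gcod.
Let scod : mor G -> ob G := if b then gcod else gdom.
Let scomp (g h : mor G) := if b then gcomp g h else gcomp h g.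

Lemma sided_dom_id f : sdom (idm f) = f.
Proof. by rewrite /sdom; case: b; rewrite ?gdom_idm ?gcod_idm. Qed.

Lemma sided_cod_id f : scod (idm f) = f.
Proof. by rewrite /scod; case: b; rewrite ?gdom_idm ?gcod_idm. Qed.

Lemma sided_dom_comp g h : sdom g = scod h -> sdom (scomp g h) = sdom h.
Proof.
by rewrite /sdom/scod/scomp; case: b => gh; rewrite ?gdom_comp ?gcod_comp.
Qed.

Lemma sided_cod_comp g h : sdom g = scod h -> scod (scomp g h) = scod g.
Proof.
by rewrite /sdom/scod/scomp; case: b => gh; rewrite ?gdom_comp ?gcod_comp.
Qed.

Lemma sided_idl g : scomp (idm (scod g)) g = g.
Proof. by rewrite /scod/scomp; case: b; rewrite ?gcomp_idl ?gcomp_idr. Qed.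

Lemma sided_idr g : scomp g (idm (sdom g)) = g.
Proof. by rewrite /sdom/scomp; case: b; rewrite ?gcomp_idl ?gcomp_idr. Qed.

Lemma sided_compA g h k : sdom g = scod h -> sdom h = scod k ->
  scomp g (scomp h k) = scomp (scomp g h) k.
Proof.
by rewrite /sdom/scod/scomp; case: b => gh hk; rewrite gcompA.
Qed.

Lemma sided_iso g : exists h, [/\ sdom h = scod g, scod h = sdom g,
  scomp g h = idm (scod g) & scomp h g = idm (sdom g)].
Proof.
by have [h [? ? ? ?]] := mor_iso g; exists h; rewrite /sdom/scod/scomp; case: b.
Qed.

Definition sided : groupoid :=
  Groupoid sided_dom_id sided_cod_id sided_dom_comp sided_cod_comp
    sided_idl sided_idr sided_compA sided_iso.

End Sided.

Section VertexGroup.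
Variables (G : groupoid) (f : ob G).

Definition vertex : Type :=
  {g : mor G | `[< gdom g = f /\ gcod g = f >]}.

HB.instance Definition _ := Choice.on vertex.

Lemma vertexP (g : vertex) : gdom (val g) = f /\ gcod (val g) = f.
Proof. by case: g => g /= /asboolP. Qed.

Lemma vertex_composable (g h : vertex) : gdom (val g) = gcod (val h).
Proof. by rewrite (vertexP g).1 (vertexP h).2. Qed.

Definition vertex_one : vertex :=
  exist _ (idm f) (asboolT (conj (gdom_idm f) (gcod_idm f))).

Definition vertex_mul (g h : vertex) : vertex.
Proof.
exists (gcomp (val g) (val h)); apply/asboolP.
have gh := vertex_composable g h.
by rewrite gdom_comp // gcod_comp // (vertexP g).2 (vertexP h).1.
Defined.

Definition vertex_inv (g : vertex) : vertex.
Proof.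
exists (ginv (val g)); apply/asboolP.
by rewrite gdom_inv gcod_inv (vertexP g).1 (vertexP g).2.
Defined.

Lemma vertex_mulA : associative vertex_mul.
Proof.
by move=> g h k; apply: val_inj; apply: gcompA; exact: vertex_composable.
Qed.

Lemma vertex_mul1l : left_id vertex_one vertex_mul.
Proof.
by move=> g; apply: val_inj => /=; rewrite -[RHS]gcomp_idl (vertexP g).2.
Qed.

Lemma vertex_mul1r : right_id vertex_one vertex_mul.
Proof.
by move=> g; apply: val_inj => /=; rewrite -[RHS]gcomp_idr (vertexP g).1.
Qed.

Lemma vertex_mulVl : left_inverse vertex_one vertex_inv vertex_mul.
Proof. by move=> g; apply: val_inj => /=; rewrite gcompVl (vertexP g).1. Qed.

Lemma vertex_mulVr : right_inverse vertex_one vertex_inv vertex_mul.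
Proof. by move=> g; apply: val_inj => /=; rewrite gcompV (vertexP g).2. Qed.

HB.instance Definition _ := isGroup.Build vertex
  vertex_mulA vertex_mul1l vertex_mul1r vertex_mulVl vertex_mulVr.

End VertexGroup.

Section SidedMultiplication.
Variables (b : bool) (A : naRingType).

Definition smul (a x : A) : A := if b then namul a x else namul x a.

Lemma smulDl x : {morph smul^~ x : a c / a + c}.
Proof. by move=> a c; rewrite /smul; case: b; rewrite ?namulDl ?namulDr. Qed.

Lemma smulDr a : {morph smul a : x y / x + y}.
Proof. by move=> x y; rewrite /smul; case: b; rewrite ?namulDl ?namulDr. Qed.

Lemma smul0r x : smul 0 x = 0.
Proof. exact: morphD0 (smulDl x). Qed.

Lemma smulr0 a : smul a 0 = 0.
Proof. exact: morphD0 (smulDr a). Qed.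

End SidedMultiplication.

(** The equality i = j keeps the inner transport from being the placeholder 0. *)
Lemma transport_trans (I : Type) (R : I -> naRingType) (i j k : I) (r : R i) :
  i = j ->
  transport (R := R) k (transport (R := R) j r) = transport (R := R) k r.
Proof. by move=> ij; case: _ / ij; rewrite transport_id. Qed.

Lemma transport_neq (I : Type) (R : I -> naRingType) (i j : I) (r : R i) :
  i <> j -> transport (R := R) j r = 0.
Proof. by rewrite /transport; case: pselect. Qed.

(** * Ideals of the groupoid ring *)

Section GroupoidRingIdeals.
Variables (b : bool) (G : groupoid) (E : set (ob G)) (hE : representatives E).
Variable R : E -> unaRingType.
Local Notation rep := (repr_mor hE).
Local Notation RG := (groupoid_ring hE R).
Local Notation GG := (sided b G).
Local Notation sdom := (@gdom GG).
Local Notation scod := (@gcod GG).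
Local Notation scomp := (@gcomp GG).
Local Notation sinv := (@ginv GG).
Local Notation sideal := (fun A : naRingType => submod (@smul b A)).

(** Both ends of g lie in one component, so e(g) can be read at either. *)
Lemma repr_scod (g : mor G) : rep g = repr_ob hE (scod g).
Proof. by rewrite /=; case: b => //; exact: repr_mor_dom. Qed.

Lemma repr_scod_eq (g h : mor G) : scod g = scod h -> rep g = rep h.
Proof. by rewrite !repr_scod => ->. Qed.

(* Reading all coefficients of one component in the fixed ring R e avoids
   transports along g |-> e(g); the value is 0 when e(g) <> e. *)
Definition coefe (e : E) (x : RG) (g : mor G) : R e :=
  transport (R := R) e (coef x g).

Lemma coefeD e g : {morph (fun x => coefe e x g) : x y / x + y}.
Proof. by move=> x y; rewrite /coefe Defs.coefD transportD. Qed.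

Lemma coefe_rep (x : RG) g : coefe (rep g) x g = coef x g.
Proof. by rewrite /coefe transport_id. Qed.

Lemma coefe_neq e (x : RG) g : rep g <> e -> coefe e x g = 0.
Proof. by move=> ge; rewrite /coefe transport_neq. Qed.

Definition delta (e : E) (g : mor G) (r : R e) : RG :=
  gr_delta (transport (R := R) (rep g) r).

Lemma coefe_delta (e e' : E) (g : mor G) (r : R e) :
  rep g = e -> coefe e' (delta g r) g = transport (R := R) e' r.
Proof. by move=> ge; rewrite /coefe coef_delta transport_trans. Qed.

Lemma coefe_delta_neq (e e' : E) (g k : mor G) (r : R e) :
  g <> k -> coefe e' (delta g r) k = 0.
Proof. by move=> gk; rewrite /coefe coef_delta_neq // transport0. Qed.

Lemma mul_coef1 (x y : RG) (k g h : mor G) :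
  gdom g = gcod h -> gcomp g h = k ->
  (forall g' h', gdom g' = gcod h' -> gcomp g' h' = k -> (g', h') <> (g, h) ->
     coef x g' = 0 \/ coef y h' = 0) ->
  coef (namul x y) k = namul (transport (R := R) (rep k) (coef x g))
                             (transport (R := R) (rep k) (coef y h)).
Proof.
move=> gh ghk xy0; rewrite Defs.coefM.
have -> : namul (transport (R := R) (rep k) (coef x g))
                (transport (R := R) (rep k) (coef y h)) =
  \sum_(p \in [set (g, h)])
    namul (transport (R := R) (rep k) (coef x p.1))
          (transport (R := R) (rep k) (coef y p.2)).
  by rewrite fsbig_set1.
apply/esym/fsbig_widen => [_ -> //|[g' h'] [[/= gh' ghk'] /= Np]].
by case: (xy0 _ _ gh' ghk' Np) => ->; rewrite transport0 ?namul0r ?namulr0.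
Qed.

Lemma mul_coef0 (x y : RG) (k : mor G) :
  (forall g h, gdom g = gcod h -> gcomp g h = k ->
     coef x g = 0 \/ coef y h = 0) ->
  coef (namul x y) k = 0.
Proof.
move=> xy0; rewrite Defs.coefM; apply: fsbig1 => -[g h] [/= gh ghk].
by case: (xy0 _ _ gh ghk) => ->; rewrite transport0 ?namul0r ?namulr0.
Qed.

(** Once g is fixed as one factor, invertibility leaves g^-1 k as the only possible other factor of
    k in the sided groupoid. *)
Lemma coef_smul_delta (g : mor G) (r : R (rep g)) (x : RG) (k : mor G) :
  scod g = scod k ->
  coef (smul b (gr_delta r) x) k = smul b (transport (R := R) (rep k) r)
     (transport (R := R) (rep k) (coef x (scomp (sinv g) k))).
Proof.
move=> gk; set h := scomp _ k.
have ghk : scomp g h = k by exact: gcompVK.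
have gh : sdom g = scod h by rewrite gcod_comp ?gcod_inv // gdom_inv.
have uniq_h h' : sdom g = scod h' -> scomp g h' = k -> h' = h.
  by move=> gh' ghk'; rewrite /h -ghk' gcompKV.
move: h ghk gh uniq_h; rewrite /smul; case: b => h ghk gh uniq_h.
- rewrite (mul_coef1 (gh : @gdom G g = @gcod G h) (ghk : @gcomp G g h = k))
    ?coef_delta // => g' h' gh' gh'k N; left.
  apply: coef_delta_neq => gg'; move: gh' gh'k N.
  rewrite -gg' => gh' gh'k; apply.
  by rewrite (uniq_h h').
- rewrite (mul_coef1 (esym gh : @gdom G h = @gcod G g)
      (ghk : @gcomp G h g = k)) ?coef_delta // => h' g' gh' gh'k N; right.
  apply: coef_delta_neq => gg'; move: gh' gh'k N.
  rewrite -gg' => gh' gh'k; apply.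
  by rewrite (uniq_h h').
Qed.

Lemma coef_smul_delta0 (g : mor G) (r : R (rep g)) (x : RG) (k : mor G) :
  scod g <> scod k -> coef (smul b (gr_delta r) x) k = 0.
Proof.
rewrite /smul; case: b => gk; apply: mul_coef0 => g' h' gh' ghk.
- left; apply: coef_delta_neq => gg'; apply: gk.
  by rewrite -ghk gg'; exact: esym (gcod_comp gh').
- right; apply: coef_delta_neq => gg'; apply: gk.
  by rewrite -ghk gg'; exact: esym (gdom_comp gh').
Qed.

Lemma coefe_smul_delta e (g : mor G) (r : R (rep g)) (x : RG) (k : mor G) :
  scod g = scod k ->
  coefe e (smul b (gr_delta r) x) k =
  smul b (transport (R := R) e r) (coefe e x (scomp (sinv g) k)).
Proof.
move=> gk; have [ke|ke] := pselect (rep k = e); last first.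
  by rewrite coefe_neq // transport_neq ?smul0r // (repr_scod_eq gk).
by case: _ / ke; rewrite coefe_rep coef_smul_delta.
Qed.

Lemma coefe_smul_delta0 e (g : mor G) (r : R (rep g)) (x : RG) (k : mor G) :
  scod g <> scod k -> coefe e (smul b (gr_delta r) x) k = 0.
Proof. by move=> gk; rewrite /coefe coef_smul_delta0 // transport0. Qed.

Lemma coef_add_morph g : {morph (fun x : RG => coef x g) : x y / x + y}.
Proof. by []. Qed.

Lemma sum_delta (x : RG) :
  x = \sum_(g <- fset_set [set g | coef x g <> 0]) gr_delta (coef x g).
Proof.
apply: groupoid_ringP => k; rewrite (morphD_sum (coef_add_morph k)).
have [xk|xk] := pselect (coef x k = 0).
  rewrite xk big1 // => g _; have [->|gk] := eqVneq g k.
    by rewrite coef_delta.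
  by rewrite coef_delta_neq //; exact/eqP.
rewrite (bigD1_seq k) ?fset_uniq //; last first.
  by rewrite (in_fset_set (coef_fin x)); exact: mem_set.
rewrite coef_delta big1 => [|g gk]; first exact: esym (addr0 _).
by rewrite coef_delta_neq //; exact/eqP.
Qed.

(** Multiplication is additive in the multiplier, and every multiplier is a finite sum of terms r
    delta_g. *)
Lemma sideal_delta (I : set RG) : additive_subgroup I ->
  (forall g (r : R (rep g)) x, I x -> I (smul b (gr_delta r) x)) ->
  sideal RG I.
Proof.
move=> sI Id; split=> // a x Ix; rewrite (sum_delta a).
rewrite (morphD_sum (smulDl b x)); apply: additive_subgroup_sum => // g _.
exact: Id.
Qed.

Section Coefficients.
Variable e : E.

(** For an ideal J, coefficients outside the component of e are unrestricted, as [coefe] sends them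
    to 0. *)
Definition coefe_ideal (J : set (R e)) : set RG :=
  [set x | forall g, J (coefe e x g)].

Lemma coefe_ideal_sideal J : sideal (R e) J -> sideal RG (coefe_ideal J).
Proof.
move=> [[J0 JD JN] Ja]; apply: sideal_delta; first split.
- by move=> g; rewrite (morphD0 (coefeD e g)).
- by move=> x y Jx Jy g; rewrite coefeD; exact: JD.
- by move=> x Jx g; rewrite (morphDN (coefeD e g)); exact: JN.
move=> g r x Jx k; have [gk|gk] := pselect (scod g = scod k).
  by rewrite coefe_smul_delta //; exact: Ja.
by rewrite coefe_smul_delta0.
Qed.

Lemma repr_idm : rep (idm (val e)) = e.
Proof.
apply: repr_ob_unique; rewrite gcod_idm; exists (idm (val e)).
by rewrite gdom_idm gcod_idm.
Qed.

Lemma coefe_ideal_delta J (r : R e) : sideal (R e) J ->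
  coefe_ideal J (delta (idm (val e)) r) <-> J r.
Proof.
move=> [[J0 _ _] _]; split=> [/(_ (idm (val e)))|Jr g].
  by rewrite coefe_delta ?repr_idm // transport_id.
have [<-|gk] := eqVneq (idm (val e)) g.
  by rewrite coefe_delta ?repr_idm // transport_id.
by rewrite coefe_delta_neq //; exact/eqP.
Qed.

Lemma dcc_coefficients :
  descending_chain_condition (sideal RG) ->
  descending_chain_condition (sideal (R e)).
Proof.
apply: (dcc_transfer (f := coefe_ideal)).
- exact: coefe_ideal_sideal.
- by move=> I J IJ x Ix g; exact: IJ.
- move=> I J sI sJ IJ; apply/seteqP; split=> r.
    move=> /(coefe_ideal_delta _ sI); rewrite IJ.
    by move=> /(coefe_ideal_delta _ sJ).
  move=> /(coefe_ideal_delta _ sJ); rewrite -IJ.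
  by move=> /(coefe_ideal_delta _ sI).
Qed.

End Coefficients.

(** Multiplication on the chosen side preserves [sdom], so the elements vanishing on morphisms with
    [sdom] in A form an ideal I A. If ob(G) were infinite, take I A minimal among the A with
    infinite complement and add to A an object f outside it: the element 1 delta_f leaves the ideal,
    against minimality. *)
Lemma dcc_finite_ob :
  descending_chain_condition (sideal RG) -> finite_set [set: ob G].
Proof.
move=> dcc; apply: contrapT => obinf.
pose I (A : set (ob G)) : set RG :=
  [set x | forall g : mor G, A (sdom g) -> coef x g = 0].
have sI A : sideal RG (I A).
  apply: sideal_delta; first split.
  - by [].
  - by move=> x y Ax Ay g Ag; rewrite Defs.coefD Ax // Ay // addr0.
  - by move=> x Ax g Ag; rewrite (morphDN (coef_add_morph g)) Ax // oppr0.
  move=> g r x Ax k Ak; have [gk|gk] := pselect (scod g = scod k); last first.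
    exact: coef_smul_delta0.
  rewrite coef_smul_delta // Ax ?transport0 ?smulr0 //.
  by rewrite gdom_comp // gdom_inv.
have [L||_ [A Ainf ->] Amin] := dcc_minimal (P := sideal RG)
    (Q := fun L => exists2 A, infinite_set (~` A) & L = I A) dcc.
- by move=> [A _ ->].
- by exists (I set0), set0 => //; rewrite setC0.
have [f Af] : exists f, ~ A f.
  apply: contrapT => NA; apply: Ainf; rewrite (_ : ~` A = set0) ?finite_set0 //.
  by apply/seteqP; split=> // g Ag; apply: NA; exists g.
have AA' : I (A `|` [set f]) = I A.
  apply: Amin; last by move=> x Ax g Ag; apply: Ax; left.
  exists (A `|` [set f]) => //; rewrite setCU.
  by apply: infinite_setD => //; exact: finite_set1.
have : I A (gr_delta (naone : R (rep (idm f)))).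
  move=> g Ag; apply: coef_delta_neq => fg; apply: Af.
  by rewrite -fg (@gdom_idm GG _) in Ag.
rewrite -AA' => /(_ (idm f)); rewrite coef_delta => one0.
have /eqP := @naone_neq0 (R (rep (idm f))); apply; apply: one0.
by right; exact: (@gdom_idm GG _).
Qed.

Lemma dcc_groupoid_ring : finite_set [set: mor G] ->
  (forall e, descending_chain_condition (sideal (R e))) ->
  descending_chain_condition (sideal RG).
Proof.
move=> /finite_seqP[s sE] dccR I sI IS.
have Ile m n : (m <= n)%N -> I n `<=` I m.
  move=> /subnK <-; elim: (n - m)%N => [|k IHk] //=.
  exact: subset_trans (IS _) IHk.
(* These are leading coefficients at g, the positions in l being already cleared. *)
pose lead (l : seq (mor G)) g n : set (R (rep g)) :=
  (fun x => coef x g) @` [set x | I n x /\ forall h, h \in l -> coef x h = 0].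
have slead l g n : sideal (R (rep g)) (lead l g n).
  have [[I0 ID IN] Ia] := sI n; split; first split.
  - by exists 0.
  - move=> _ _ [x [Ix lx] <-] [y [Iy ly] <-]; exists (x + y) => //.
    by split=> [|h hl]; [exact: ID|rewrite Defs.coefD lx // ly // addr0].
  - move=> _ [x [Ix lx] <-]; exists (- x) => //; split; first exact: IN.
    by move=> h hl; rewrite (morphDN (coef_add_morph h)) lx // oppr0.
  move=> a _ [x [Ix lx] <-].
  (* Multiplying by a delta_i acts by a on the coefficient at g and keeps the zeros on l. *)
  pose i : mor G := idm (scod g).
  have gi : scod i = scod g by exact: (@gcod_idm GG _).
  have ig : rep g = rep i by apply: repr_scod_eq.
  exists (smul b (delta i a) x); last first.
    rewrite /delta coef_smul_delta // gcomp_invid // transport_trans //.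
    by rewrite !transport_id.
  split=> [|h hl]; first exact: Ia.
  have [ih|ih] := pselect (scod i = scod h); last exact: coef_smul_delta0.
  by rewrite coef_smul_delta // gcomp_invid -?ih // lx // transport0 smulr0.
(* Induction on the list l' of positions still to be cleared; when it is empty, x = 0. *)
have claim (l' l : seq (mor G)) : (forall g, g \in l' ++ l) ->
  exists N, forall n x, (N <= n)%N -> I N x ->
    (forall h, h \in l -> coef x h = 0) -> I n x.
  elim: l' l => [|g l' IHl] l ll.
    exists 0%N => n x _ Ix lx.
    rewrite (_ : x = 0); first by case: (sI n) => -[].
    by apply: groupoid_ringP => g; exact: lx.
  have [|N2 N2P] := IHl (g :: l).
    by move=> h; have := ll h; rewrite /= inE !mem_cat inE orbCA.
  have [||N1 N1P] := dccR (rep g) (lead l g) => [n|n|]; first exact: slead.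
    by move=> _ [x [Ix lx] <-]; exists x => //; split=> //; exact: IS.
  exists (maxn N1 N2) => n x; rewrite geq_max => /andP[N1n N2n] Ix lx.
  have : lead l g N1 (coef x g).
    by exists x => //; split=> //; apply: Ile Ix; rewrite leq_maxl.
  (* Some y in I n has the leading coefficient of x, and x - y vanishes on g :: l, so the induction
     hypothesis puts x - y in I n. *)
  rewrite -(N1P n) // => -[y [Iy ly] yx].
  rewrite -[x](subrK y); have [[_ ID _] _] := sI n; apply: ID => //.
  apply: N2P => //.
    apply: additive_subgroupB (sI _).1 _ _.
      by apply: Ile Ix; rewrite leq_maxr.
    exact: Ile Iy.
  move=> h; rewrite inE (morphDB (coef_add_morph h)) => /orP[/eqP ->|hl].
    by rewrite yx subrr.
  by rewrite lx // ly // subrr.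
have [|N NP] := claim s [::].
  by move=> g; rewrite cats0; have : [set: mor G] g by []; rewrite sE.
exists N => n Nn; apply/seteqP; split; first exact: Ile.
by move=> x Ix; exact: NP.
Qed.

End GroupoidRingIdeals.

(** * Subgroups as abelian groups *)

Section SubgroupType.
Variables (A : zmodType) (N : set A).

(** The proof is an argument of the type, so that the group structure below can be inferred from the
    type alone. *)
Definition subgroup_type of additive_subgroup N : Type := {x : A | `[< N x >]}.

Variable sN : additive_subgroup N.

HB.instance Definition _ := Choice.on (subgroup_type sN).

Implicit Types x y : subgroup_type sN.

Definition subgroup_val x : A := val x.

Lemma subgroup_valP x : N (subgroup_val x).
Proof. exact: (asboolW (valP x)). Qed.

Lemma subgroup_val_inj : injective subgroup_val.
Proof. by move=> x y xy; apply: val_inj. Qed.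

Definition subgroup_mk a (Na : N a) : subgroup_type sN :=
  exist _ a (asboolT Na).

Let Nadd x y : N (subgroup_val x + subgroup_val y).
Proof. by case: sN => _ ND _; apply: ND; exact: subgroup_valP. Qed.

Let Nopp x : N (- subgroup_val x).
Proof. by case: sN => _ _ NN; apply: NN; exact: subgroup_valP. Qed.

Let Nzero : N 0. Proof. by case: sN. Qed.

Definition subgroup_zero := subgroup_mk Nzero.
Definition subgroup_opp x := subgroup_mk (Nopp x).
Definition subgroup_add x y := subgroup_mk (Nadd x y).

Lemma subgroup_addA : associative subgroup_add.
Proof. by move=> x y z; apply: subgroup_val_inj; exact: addrA. Qed.

Lemma subgroup_addC : commutative subgroup_add.
Proof. by move=> x y; apply: subgroup_val_inj; exact: addrC. Qed.

Lemma subgroup_add0 : left_id subgroup_zero subgroup_add.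
Proof. by move=> x; apply: subgroup_val_inj; exact: add0r. Qed.

Lemma subgroup_addN : left_inverse subgroup_zero subgroup_opp subgroup_add.
Proof. by move=> x; apply: subgroup_val_inj; exact: addNr. Qed.

HB.instance Definition _ := GRing.isZmodule.Build (subgroup_type sN)
  subgroup_addA subgroup_addC subgroup_add0 subgroup_addN.

End SubgroupType.

(** * Finiteness of the vertex groups *)

Section VertexGroupFinite.
Variables (b : bool) (G : groupoid) (E : set (ob G)) (hE : representatives E).
Variable R : E -> unaRingType.
Local Notation rep := (repr_mor hE).
Local Notation RG := (groupoid_ring hE R).
Local Notation GG := (sided b G).
Local Notation sdom := (@gdom GG).
Local Notation scod := (@gcod GG).
Local Notation scomp := (@gcomp GG).
Local Notation sinv := (@ginv GG).
Local Notation sideal := (fun A : naRingType => submod (@smul b A)).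

Hypothesis dcc : descending_chain_condition (sideal RG).
Variable f : ob G.
Local Notation e := (repr_ob hE f).
Local Notation T := (vertex (f : ob GG)).

Section Transfer.
Variables (N : set (R e)) (sN : sideal (R e) N).
Local Notation W := (subgroup_type (proj1 sN)).
Local Notation X := {malg W[T]}.

Definition sub_act (a : R e) (w : W) : W :=
  subgroup_mk (proj1 sN) (proj2 sN a _ (subgroup_valP w)).

Lemma sub_actD a : {morph sub_act a : v w / v + w}.
Proof. by move=> v w; apply: subgroup_val_inj; exact: smulDr. Qed.

Lemma repr_vertex (g : T) : rep (val g) = e.
Proof. by rewrite (repr_scod b) (vertexP g).2. Qed.

(** These elements serve to recover a submodule of X from the ideal that it induces. *)
Definition embed (z : X) : RG :=
  \sum_(g <- msupp z) delta hE (val g) (subgroup_val z@_g).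

Lemma coefe_embed z (g : T) : coefe e (embed z) (val g) = subgroup_val z@_g.
Proof.
rewrite /embed (morphD_sum (coefeD e _)).
have coef0 h : h != g ->
    coefe e (delta hE (val h) (subgroup_val z@_h) : RG) (val g) = 0.
  by move=> hg; apply: coefe_delta_neq => /val_inj/eqP; exact/negP.
have [gz|gz] := boolP (g \in msupp z).
  rewrite (bigD1_seq g) ?fset_uniq // big1 => [|h hg]; last exact: coef0.
  rewrite [LHS]addr0; apply: etrans (coefe_delta _ _ (repr_vertex g)) _.
  by rewrite transport_id.
rewrite big_seq big1 => [|h hz]; first by rewrite mcoeff_outdom.
by apply: coef0; apply: contra gz => /eqP <-.
Qed.

Lemma coefe_embed0 z (k : mor G) : scod k <> f -> coefe e (embed z) k = 0.
Proof.
move=> kf; rewrite /embed (morphD_sum (coefeD e _)) big1 // => g _.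
by apply: coefe_delta_neq => gk; apply: kf; rewrite -gk (vertexP g).2.
Qed.

(* x is cut into pieces along the left cosets h T; each has to lie in L. *)
Definition induced_ideal (L : set X) : set RG :=
  [set x | forall h : mor G, sdom h = f -> exists2 z, L z &
     forall g : T, coefe e x (scomp h (val g)) = subgroup_val z@_g].

Lemma induced_ideal_sideal L :
  submod (gact sub_act (T := T)) L -> sideal RG (induced_ideal L).
Proof.
move=> [[L0 LD LN] La]; apply: sideal_delta; first split.
- by move=> h _; exists 0 => // g; rewrite mcoeff0 (morphD0 (coefeD e _)).
- move=> x y Lx Ly h hf; have [z Lz xz] := Lx h hf; have [t Lt yt] := Ly h hf.
  exists (z + t) => [|g]; first exact: LD.
  by rewrite coefeD xz yt mcoeffD.
- move=> x Lx h hf; have [z Lz xz] := Lx h hf.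
  exists (- z) => [|g]; first exact: LN.
  by rewrite (morphDN (coefeD e _)) xz mcoeffN.
move=> k r x Lx h hf.
have hg (g : T) : sdom h = scod (val g) by rewrite hf (vertexP g).2.
have [kh|kh] := pselect (scod k = scod h); last first.
  exists 0 => // g; rewrite coefe_smul_delta0 ?mcoeff0 //.
  by rewrite gcod_comp.
(* The piece of the product along h T is r acting on the piece of x along k^-1 h T. *)
have [|z Lz xz] := Lx (scomp (sinv k) h).
  by rewrite gdom_comp // gdom_inv.
exists (cact sub_act (transport (R := R) e r) z) => [|g].
  exact: (La (inl _)).
rewrite coefe_smul_delta ?gcod_comp // mcoeff_cact; last exact: sub_actD.
by rewrite gcompA ?gdom_inv // xz.
Qed.

Lemma induced_ideal_embed L z :
  submod (gact sub_act (T := T)) L -> induced_ideal L (embed z) <-> L z.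
Proof.
move=> [[L0 LD LN] La]; split=> [|Lz h hf].
  (* The piece along the coset of the identity is z itself. *)
  move=> /(_ (idm f)); rewrite (@gdom_idm GG) => /(_ erefl)[z' Lz' zz'].
  suff -> : z = z' by [].
  apply/malgP => g; apply: subgroup_val_inj; rewrite -zz' -coefe_embed.
  congr coefe.
  exact: esym (gcomp_idm (vertexP g).2).
have hg (g : T) : sdom h = scod (val g) by rewrite hf (vertexP g).2.
have [hf'|hf'] := pselect (scod h = f); last first.
  by exists 0 => // g; rewrite coefe_embed0 ?mcoeff0 // gcod_comp.
(* For a loop h at f, the piece along h T is the left translate of z by h^-1. *)
have hT : `[< sdom h = f /\ scod h = f >] by apply/asboolP.
pose k : T := exist _ h hT.
exists (ltrans k^-1%g z) => [|g]; first exact: (La (inr _)).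
rewrite mcoeff_ltrans invgK -coefe_embed.
by [].
Qed.

Lemma dcc_induced : descending_chain_condition (submod (gact sub_act (T := T))).
Proof.
apply: (dcc_transfer (f := induced_ideal) _ _ _ dcc) => [||L M sL sM LM].
- exact: induced_ideal_sideal.
- by move=> L M LM x Lx h hf; have [z /LM Mz xz] := Lx h hf; exists z.
- apply/seteqP; split=> z.
    move=> /(induced_ideal_embed _ sL); rewrite LM.
    by move=> /(induced_ideal_embed _ sM).
  move=> /(induced_ideal_embed _ sM); rewrite -LM.
  by move=> /(induced_ideal_embed _ sL).
Qed.

End Transfer.

Lemma dcc_vertex_finite : finite_set [set: T].
Proof.
have [L||N [sN [r Nr r0]] Nmin] := dcc_minimal (P := sideal (R e))
  (Q := fun N => sideal (R e) N /\ exists2 r, N r & r <> 0)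
  (dcc_coefficients (e := e) dcc).
- by case.
- exists setT; split; first exact: submodT.
  by exists naone => //; apply/eqP; exact: naone_neq0.
apply: (dcc_group_finite (@sub_actD N sN) _ (@dcc_induced N sN)).
split.
  by exists (subgroup_mk (proj1 sN) Nr) => /(congr1 (@subgroup_val _ _ _)).
move=> M sM [m Mm m0] w.
(* A nonzero submodule of N is a nonzero ideal of R_e, so minimality makes N simple. *)
have MN : @subgroup_val _ _ (proj1 sN) @` M = N.
  apply: Nmin; last by move=> _ [x _ <-]; exact: subgroup_valP.
  split; first by apply: submod_image sM; split.
  exists (subgroup_val m); first by exists m.
  by move=> m00; apply: m0; exact: subgroup_val_inj.
have := subgroup_valP w; rewrite -{1}MN => -[x Mx /subgroup_val_inj xw].
by rewrite -xw.
Qed.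

End VertexGroupFinite.

(** * Finiteness of the set of morphisms and conclusion *)

Lemma finite_mor (G : groupoid) : finite_set [set: ob G] ->
  (forall f : ob G, finite_set [set: vertex f]) -> finite_set [set: mor G].
Proof.
move=> fob fv.
pose hom (p : ob G * ob G) : set (mor G) :=
  [set g | gdom g = p.1 /\ gcod g = p.2].
have -> : [set: mor G] = \bigcup_(p in [set: ob G] `*` [set: ob G]) hom p.
  by apply/seteqP; split=> // g _; exists (gdom g, gcod g).
apply: bigcup_finite; first exact: finite_setX.
move=> [a c] _.
have [[h0 [/= h0a h0c]]|Nh] := pselect (exists h, hom (a, c) h); last first.
  rewrite (_ : hom _ = set0) ?finite_set0 //.
  by apply/seteqP; split=> // h hh; apply: Nh; exists h.
(* Composition with h0 carries the vertex group at a onto the morphisms from a to c. *)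
apply: sub_finite_set
  (finite_image (fun g : vertex a => gcomp h0 (val g)) (fv a)).
move=> g [/= ga gc].
have gh : `[< gdom (gcomp (ginv h0) g) = a /\ gcod (gcomp (ginv h0) g) = a >].
  apply/asboolP; rewrite gdom_comp ?gcod_comp ?gdom_inv ?gcod_inv ?h0c ?gc //.
exists (exist _ (gcomp (ginv h0) g) gh : vertex a) => //=.
by rewrite gcompVK // h0c.
Qed.

Theorem sided_artinian (b : bool) (G : groupoid) (E : set (ob G))
    (hE : representatives E) (R : E -> unaRingType) :
  descending_chain_condition (submod (@smul b (groupoid_ring hE R))) <->
  finite_set [set: mor G] /\
    forall e : E, descending_chain_condition (submod (@smul b (R e))).
Proof.
split=> [dcc|[fG dccR]]; last exact: dcc_groupoid_ring.
split; last by move=> e; exact: dcc_coefficients dcc.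
(* The vertex groups known to be finite are those of the sided groupoid, which has the same objects
   and morphisms as G. *)
apply: (@finite_mor (sided b G)); first exact: dcc_finite_ob dcc.
exact: dcc_vertex_finite dcc.
Qed.

Theorem theorem4p1 (G : groupoid) (E : set (ob G)) (hE : representatives E)
    (R : E -> unaRingType) :
  (left_artinian (groupoid_ring hE R) <->
     finite_set [set: mor G] /\ forall e : E, left_artinian (R e)) /\
  (right_artinian (groupoid_ring hE R) <->
     finite_set [set: mor G] /\ forall e : E, right_artinian (R e)).
Proof.
(* For each value of the boolean, [submod] over [smul] is convertible to the corresponding notion of
   one-sided ideal. *)
by split; [exact: (sided_artinian true)|exact: (sided_artinian false)].
Qed.
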